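(* Let $T>0$ and let $f,g:[0,T]\to\mathbb{R}$ be functions of bounded variation. Let $G$ be one of the seven centered Gaussian processes (E1)--(E7) listed in the context, with covariance $R(s,t)$; let $B^H$ be the fractional Brownian motion with the same exponent $H$, with covariance $R^B(s,t)=\frac12[s^{2H}+t^{2H}-|t-s|^{2H}]$; and denote by $\mathfrak H$ and $\mathfrak H_1$ the canonical Hilbert spaces associated to $G$ and $B^H$ respectively (see context). (i) For (E1) and (E2), $$\langle f,g\rangle_{\mathfrak H}=\int_0^Tf(t)\,\mathrm{d}t\int_0^Tg(s)\frac{\partial^2R(s,t)}{\partial s\,\partial t}\,\mathrm{d}s,$$ where $\frac{\partial^2R(s,t)}{\partial s\partial t}=H|2H-1|(t+s)^{2H-2}$ for (E1) and $\frac{\partial^2R(s,t)}{\partial s\partial t}=(2H')^2K(1-K)(ts)^{2H'-1}(t^{2H'}+s^{2H'})^{K-2}$ for (E2). (ii) For (E3), $$\langle f,g\rangle_{\mathfrak H}=H(2H-1)\int_{[0,T]^2}f(t)g(s)(t+s)^{2H-2}\,\mathrm{d}t\,\mathrm{d}s+H\int_0^Tf(t)g(t)t^{2H-1}\,\mathrm{d}t.$$ (iii) For (E4), $$\langle f,g\rangle_{\mathfrak H}=2H\,\Gamma(1-2H)\int_0^Tf(t)g(t)t^{2H-1}\,\mathrm{d}t.$$ (iv) For (E5) and (E6), $$\langle f,g\rangle_{\mathfrak H}-\langle f,g\rangle_{\mathfrak H_1}=\int_0^Tf(t)\,\mathrm{d}t\int_0^Tg(s)\frac{\partial}{\partial s}\Big(\frac{\partial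 R(s,t)}{\partial t}-\frac{\partial R^B(s,t)}{\partial t}\Big)\mathrm{d}s,$$ where $$\frac{\partial}{\partial s}\Big(\frac{\partial R(s,t)}{\partial t}-\frac{\partial R^B(s,t)}{\partial t}\Big)=H'K\big[4H'(K-1)(s^{2H'}+t^{2H'})^{K-2}(ts)^{2H'-1}-(2H'K-1)(s+t)^{2H'K-2}\big]$$ for (E5), and $$\frac{\partial}{\partial s}\Big(\frac{\partial R(s,t)}{\partial t}-\frac{\partial R^B(s,t)}{\partial t}\Big)=-\frac{2H(2H-1)ab}{a^2+b^2}(t+s)^{2H-2}$$ for (E6). (v) For (E7), $$\langle f,g\rangle_{\mathfrak H}-\langle f,g\rangle_{\mathfrak H_1}=-H\int_0^Tf(t)g(t)t^{2H-1}\,\mathrm{d}t,$$ which implies that if the intersection of the supports of $f$ and $g$ has Lebesgue measure zero, then $$\langle f,g\rangle_{\mathfrak H}=\langle f,g\rangle_{\mathfrak H_1}=H(2H-1)\int_{[0,T]^2}f(t)g(s)|t-s|^{2H-2}\,\mathrm{d}t\,\mathrm{d}s.$$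
   Context: Centered Gaussian processes $G=(G_t)_{t\ge0}$ with covariance $R(s,t)=\mathbb{E}[G_sG_t]$, $s,t\ge0$: (E1) $G_t=\sqrt{C_H}\int_0^\infty(1-e^{-rt})r^{-\frac{1+2H}{2}}\,\mathrm{d}W_r$, $W$ a standard Brownian motion, $H\in(0,\frac12)\cup(\frac12,1)$, $C_H=\frac{H}{\Gamma(1-2H)}$ if $H<\frac12$, $C_H=\frac{H(2H-1)}{\Gamma(2-2H)}$ if $H>\frac12$; its covariance is $R(s,t)=\frac12[t^{2H}+s^{2H}-(t+s)^{2H}]$ if $H<\frac12$ and $R(s,t)=\frac12[(t+s)^{2H}-t^{2H}-s^{2H}]$ if $H>\frac12$. (E2) Trifractional Brownian motion: $R(s,t)=t^{2H'K}+s^{2H'K}-(t^{2H'}+s^{2H'})^K$, $H'\in(0,1)$, $K\in(0,1)$, $H:=H'K$. (E3) $R(s,t)=\frac12[(t+s)^{2H}-(\max(s,t))^{2H}]$, $H\in(0,\frac12]$. (E4) $R(s,t)=\Gamma(1-2H)(\min(s,t))^{2H}$, $H\in(0,\frac12)$. (E5) Generalized sub-fractional Brownian motion: $R(s,t)=(s^{2H'}+t^{2H'})^K-\frac12[(t+s)^{2H'K}+|t-s|^{2H'K}]$, $H'\in(0,1)$, $K\in(0,2)$, $H:=H'K\in(0,1)$. (E6) Generalized fractional Brownian motion: $R(s,t)=\frac{(a+b)^2}{2(a^2+b^2)}(s^{2H}+t^{2H})-\frac{ab}{a^2+b^2}(s+t)^{2H}-\frac12|t-s|^{2H}$, $H\in(0,1)$,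 $(a,b)\in\mathbb{R}^2\setminus\{(0,0)\}$. (E7) $R(s,t)=\frac12[(\max(s,t))^{2H}-|t-s|^{2H}]$, $H\in(0,\frac12]$. Canonical Hilbert space. For a centered Gaussian process $G$ on $[0,T]$, its canonical Hilbert space is the closure (completion) of the space of real-valued step functions on $[0,T]$ with respect to the inner product determined by $\langle \mathbf 1_{[a,b]},\mathbf 1_{[c,d]}\rangle_{\mathfrak H}=\mathbb{E}[(G_b-G_a)(G_d-G_c)]$. Functions of bounded variation on $[0,T]$ are regarded as elements of it, and for such $f,g$ the inner product is $\langle f,g\rangle_{\mathfrak H}=\int_{[0,T]^2}R(s,t)\,\mathrm{d}(\nu_f\times\nu_g)(s,t)$ (a known formula of Jolis). Here $\nu_g$ is the restriction to $([0,T],\mathcal B([0,T]))$ of the Lebesgue--Stieltjes signed measure on $\mathbb{R}$ of the function $g^0$ equal to $g$ on $[0,T]$ and $0$ elsewhere. *)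

(* Defs.v *)
From HB Require Import structures.
From mathcomp Require Import all_boot all_order all_algebra.
From mathcomp Require Import all_classical all_reals all_analysis.

Set Implicit Arguments.
Unset Strict Implicit.
Unset Printing Implicit Defensive.

Import Order.TTheory GRing.Theory Num.Theory.
Import numFieldNormedType.Exports.

Local Open Scope classical_set_scope.
Local Open Scope ring_scope.

(* Centered normal law, Dirac at 0 in the degenerate case: the library's
   [normal_prob m 0] is a uniform law, not a Dirac mass. *)
Definition centered_normal d (Om : measurableType d) (R : realType)
    (P : probability Om R) (X : Om -> R) : Prop :=
  exists sigma : R, forall A : set R, measurable A ->
    P (X @^-1` A) = if sigma == 0 then \d_(0 : R) A else normal_prob 0 sigma A.

(* Time runs over [0, +oo[: the values of [gp_fun] at negative times are
   irrelevant. *)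
Record centeredGaussianProcess (R : realType) := CenteredGaussianProcess {
  gp_disp : measure_display;
  gp_dom : measurableType gp_disp;
  gp_prob : probability gp_dom R;
  gp_fun :> R -> {RV gp_prob >-> R};
  gp_gaussian : forall (n : nat) (t c : 'I_n -> R), (forall i, 0 <= t i) ->
    centered_normal gp_prob (fun w => \sum_(i < n) c i * gp_fun (t i) w) }.

Definition has_covariance (R : realType) (G : centeredGaussianProcess R)
    (F : R -> R -> R) : Prop :=
  forall s t, 0 <= s -> 0 <= t ->
    ('E_(gp_prob G)[(G s \* G t)%R] = (F s t)%:E)%E.

Section canonical_hilbert_space.
Context {R : realType}.
Implicit Types (f : R -> R) (T : R).

Definition step_function T f : Prop :=
  exists (n : nat) (c a b : 'I_n -> R),
    (forall i, 0 <= a i /\ a i <= b i /\ b i <= T) /\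
    f = (fun x => \sum_(i < n) c i * \1_(`[a i, b i]) x).

(* [nu] is the Lebesgue-Stieltjes signed measure on R of [F] (not assumed
   right-continuous, hence the one-sided limits). *)
Definition lebesgue_stieltjes_charge (F : R -> R)
    (nu : {charge set (measurableTypeR R) -> \bar R}) : Prop :=
  forall a b, a <= b ->
    nu (`]a, b]%classic) =
    (lim (F x @[x --> b^'+]) - lim (F x @[x --> a^'+]))%:E.

(* The integral of [F] over [D] with respect to the product of two signed
   measures, through their Jordan decompositions. *)
Definition charge_prod_integral
    (nu1 nu2 : {charge set (measurableTypeR R) -> \bar R})
    (P1 N1 P2 N2 : set R) (h1 : hahn_decomposition nu1 P1 N1)
    (h2 : hahn_decomposition nu2 P2 N2) (D : set (R * R)) (F : R * R -> \bar R)
    : \bar R :=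
  (\int[jordan_pos h1 \x jordan_pos h2]_(p in D) F p
   - \int[jordan_pos h1 \x jordan_neg h2]_(p in D) F p
   - \int[jordan_neg h1 \x jordan_pos h2]_(p in D) F p
   + \int[jordan_neg h1 \x jordan_neg h2]_(p in D) F p)%E.

(* The canonical Hilbert space of [G] on [0, T]: a complete inner product space
   in which the step functions on [0, T], with the inner product determined by
   E[(G_b - G_a)(G_d - G_c)], are dense.  [ch_elt] also says how a function of
   bounded variation on [0, T] is regarded as an element of the space; the
   inner product of two such elements is given by Jolis's formula, where [nuf]
   is the Lebesgue-Stieltjes signed measure on R of [f] extended by 0 outside
   [0, T] (integrating over [0, T]^2 restricts it to [0, T]); [nuf] and the
   Hahn decomposition [(Pf, Nf)] are determined by [f], the latter up to
   [nuf]-null sets.  Only the restrictions of functions to [0, T] matter, and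
   [ch_elt] carries no information on functions that are not of bounded
   variation. *)
Record canonicalHilbert (G : centeredGaussianProcess R) (T : R) :=
    CanonicalHilbert {
  ch_space : completeNormedModType R;
  ch_dot : {dot ch_space for (@idfun R)};
  ch_norm : forall u : ch_space, `|u| ^+ 2 = ch_dot u u;
  ch_elt : (R -> R) -> ch_space;
  ch_linear : forall (k : R) (f g : R -> R),
    bounded_variation 0 T f -> bounded_variation 0 T g ->
    ch_elt (fun x => k * f x + g x) = k *: ch_elt f + ch_elt g;
  ch_step : forall a b c d : R,
    0 <= a <= b -> b <= T -> 0 <= c <= d -> d <= T ->
    (ch_dot (ch_elt \1_(`[a, b])) (ch_elt \1_(`[c, d])))%:E =
    'E_(gp_prob G)[((G b \- G a) \* (G d \- G c))%R]%E;
  ch_dense : forall (u : ch_space) (e : R), 0 < e ->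
    exists2 phi : R -> R, step_function T phi & `|u - ch_elt phi| < e;
  ch_jolis : forall (f g : R -> R)
      (nuf nug : {charge set (measurableTypeR R) -> \bar R})
      (Pf Nf Pg Ng : set R) (hf : hahn_decomposition nuf Pf Nf)
      (hg : hahn_decomposition nug Pg Ng),
    bounded_variation 0 T f -> bounded_variation 0 T g ->
    lebesgue_stieltjes_charge (f \_ `[0, T]) nuf ->
    lebesgue_stieltjes_charge (g \_ `[0, T]) nug ->
    (ch_dot (ch_elt f) (ch_elt g))%:E =
    charge_prod_integral hf hg (`[0, T] `*` `[0, T])
      (fun p => 'E_(gp_prob G)[(G p.1 \* G p.2)%R]%E) }.

Definition inner (G : centeredGaussianProcess R) (T : R)
    (V : canonicalHilbert G T) (f g : R -> R) : R :=
  ch_dot V (ch_elt V f) (ch_elt V g).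

End canonical_hilbert_space.

Section covariances.
Context {R : realType}.
Implicit Types H K s t : R.

Definition Gamma (x : R) : R :=
  \int[lebesgue_measure]_(t in `]0, +oo[) (t `^ (x - 1) * expR (- t)).

Definition cov_fBm H s t : R :=
  2^-1 * (s `^ (2 * H) + t `^ (2 * H) - `|t - s| `^ (2 * H)).

Definition cov_E1 H s t : R :=
  if H < 2^-1 then 2^-1 * (t `^ (2 * H) + s `^ (2 * H) - (t + s) `^ (2 * H))
  else 2^-1 * ((t + s) `^ (2 * H) - t `^ (2 * H) - s `^ (2 * H)).

(* In [cov_E2] and [cov_E5], [H] is the parameter H' of the processes. *)
Definition cov_E2 H K s t : R :=
  t `^ (2 * H * K) + s `^ (2 * H * K) - (t `^ (2 * H) + s `^ (2 * H)) `^ K.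

Definition cov_E3 H s t : R :=
  2^-1 * ((t + s) `^ (2 * H) - (Num.max s t) `^ (2 * H)).

Definition cov_E4 H s t : R :=
  Gamma (1 - 2 * H) * (Num.min s t) `^ (2 * H).

Definition cov_E5 H K s t : R :=
  (s `^ (2 * H) + t `^ (2 * H)) `^ K
  - 2^-1 * ((t + s) `^ (2 * H * K) + `|t - s| `^ (2 * H * K)).

Definition cov_E6 H a b s t : R :=
  (a + b) ^+ 2 / (2 * (a ^+ 2 + b ^+ 2)) * (s `^ (2 * H) + t `^ (2 * H))
  - a * b / (a ^+ 2 + b ^+ 2) * (s + t) `^ (2 * H)
  - 2^-1 * `|t - s| `^ (2 * H).

Definition cov_E7 H s t : R :=
  2^-1 * ((Num.max s t) `^ (2 * H) - `|t - s| `^ (2 * H)).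

End covariances.

Section derivatives.
Context {R : realType}.
Implicit Types (F : R -> R -> R) (s t v : R).

(* d/ds (dF/dt) at (s, t) *)
Definition mixed F s t : R := derive1 (fun u => derive1 (F u) t) s.

(* d/ds (dF1/dt - dF2/dt) at (s, t) *)
Definition mixed_diff (F1 F2 : R -> R -> R) s t : R :=
  derive1 (fun u => derive1 (F1 u) t - derive1 (F2 u) t) s.

(* [derive1] takes a junk value where the derivative does not exist: these
   predicates assert existence as well. *)
Definition has_mixed F s t v : Prop :=
  (\forall u \near s, derivable (F u) t 1) /\
  is_derive s 1 (fun u => derive1 (F u) t) v.

Definition has_mixed_diff (F1 F2 : R -> R -> R) s t v : Prop :=
  (\forall u \near s, derivable (F1 u) t 1 /\ derivable (F2 u) t 1) /\
  is_derive s 1 (fun u => derive1 (F1 u) t - derive1 (F2 u) t) v.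

End derivatives.

(* Integrals are taken in the extended reals: an equality with a real number
   then also asserts that they converge. *)
Definition iterated_integral (R : realType) (T : R) (f g : R -> R)
    (k : R -> R -> R) : \bar R :=
  (\int[lebesgue_measure]_(t in `[0%R, T])
     ((f t)%:E * \int[lebesgue_measure]_(s in `[0%R, T]) (g s * k s t)%:E))%E.

(* The pair [p] is (t, s). *)
Definition double_integral (R : realType) (T : R) (f g : R -> R)
    (k : R -> R -> R) : \bar R :=
  (\int[lebesgue_measure \x lebesgue_measure]_(p in `[0%R, T] `*` `[0%R, T])
     (f p.1 * g p.2 * k p.2 p.1)%:E)%E.

Definition weighted_integral (R : realType) (T : R) (f g w : R -> R) : \bar R :=
  (\int[lebesgue_measure]_(t in `[0%R, T]) (f t * g t * w t)%:E)%E.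

Definition support_on (R : realType) (T : R) (f : R -> R) : set R :=
  closure [set t | t \in `[0, T] /\ f t != 0].

(* Main.v *)
Require Import Defs.
From HB Require Import structures.
From mathcomp Require Import all_boot all_order all_algebra.
From mathcomp Require Import all_classical all_reals all_analysis.
From mathcomp Require Import measurable_realfun.
From mathcomp Require Import ring lra.

(** By Jolis's formula an inner product is the integral over [0, T]^2 of a
    covariance [K] against [nu_f x nu_g], the signed measures of [f] and [g].
    The proof computes this integral, the pairing of [K], for a few elementary
    kernels whose combinations are all the covariances at hand.

    The measure of [f].  Since [f] is continued by 0 outside [0, T], the measure
    [nu_f] has mass 0 on [0, T]; and off the countable set of jumps of [f],
    [nu_f ]u, T] = - f u] and [nu_f ]u, v] = f v - f u]
    ([bounded_variation_stieltjes]).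

    The principle.  If a bounded [K] is a superposition of indicators of
    rectangles, [K s t = \int w(x) 1_(A x)(s) 1_(B x)(t) dmu(x)] with [w >= 0],
    then Tonelli's theorem, on each of the four products of Jordan parts, shows
    that [K] pairs to [\int w(x) nu_f(A x) nu_g(B x) dmu(x)], and that the last
    integral converges ([pairing_kernel]).  There are four cases.
    - A function of [s] alone or of [t] alone: one side of each rectangle is
      [0, T], so the pairing is 0 ([pairing_single_left]).
    - [min(s, t)^r] is the integral of [r u^(r - 1)] over the squares
      [`]u, T]^2], and pairs to [\int f g r u^(r - 1)] ([pairing_min]).
    - [(s^p + t^p)^q - s^(p q) - t^(p q)], which is [sum_power p q], is the
      integral over [`]0, s[ x ]0, t[] of its mixed derivative, hence a
      superposition of the quadrants [`]u, T] x ]v, T]]; it pairs to the double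
      integral of [f(u) g(v)] times that derivative ([represented_sum_power]).
    - For [0 < r < 1] the mixed derivative of [|t - s|^r] is not integrable near
      the diagonal.  But [max(s, t)^r - |t - s|^r], up to a function of
      [min(s, t)], is [r (1 - r)] times the integral of [(v - u)^(r - 2)] over the
      squares [`]u, v]^2], of mass [(f v - f u) (g v - g u)].  When [f g] vanishes
      almost everywhere, the products [f u * g u] and [f v * g v] drop out, and the
      two cross terms form the double integral of [f(t) g(s) |t - s|^(r - 2)]
      ([pairing_diagonal]).

    The covariances.  Up to constant factors, [cov_E1] is [sum_power 1 (2 H)] and
    [cov_E2] is [sum_power (2 H') K]; [cov_E3] is a combination of
    [sum_power 1 (2 H)] and [min(s, t)^(2 H)], and [cov_E4] is the latter alone.
    From [cov_E5], [cov_E6] and [cov_E7], subtracting [cov_fBm] cancels the term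
    [|t - s|^(2 H)] and leaves functions of the same kinds.  The pairing of
    [|t - s|^(2 H)] itself is evaluated only for [f g = 0] almost everywhere, in
    the last formula for [cov_E7]. *)

Set Implicit Arguments.
Unset Strict Implicit.
Unset Printing Implicit Defensive.

Import Order.TTheory GRing.Theory Num.Theory.
Import numFieldNormedType.Exports.

Local Open Scope classical_set_scope.
Local Open Scope ring_scope.

(** * The fundamental theorem of calculus with singular endpoints *)

(** The derivative may be unbounded at the endpoints, as [u `^ (p - 1)] is at 0
    for [p < 1].  The theorem on compact intervals gives the integral over
    [a + m_n, b - m_n]; nonnegativity of [f] allows passing to the limit by
    monotone convergence. *)
Lemma ge0_FTC_oo (R : realType) (f F : R -> R) (a b : R) : a < b ->
  (forall x, a < x < b -> 0 <= f x) ->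
  (forall x, a < x < b -> {for x, continuous f}) ->
  (forall x, a < x < b -> derivable F x 1 /\ 'D_1 F x = f x) ->
  F x @[x --> a^'+] --> F a -> F x @[x --> b^'-] --> F b ->
  (\int[lebesgue_measure]_(x in `]a, b[) (f x)%:E = (F b - F a)%:E)%E.
Proof.
move=> ab f0 cf dF Fa Fb.
(* With [n.+3] the interval [a + m n, b - m n] is nondegenerate for all [n]. *)
pose m (n : nat) : R := (b - a) / n.+3%:R.
have m0 n : 0 < m n by rewrite divr_gt0 ?subr_gt0.
have mle n k : (n <= k)%N -> m k <= m n.
  move=> nk; rewrite /m ler_pM2l ?subr_gt0// lef_pV2 ?posrE//.
  by rewrite ler_nat !ltnS.
have m3 n : 3 * m n <= b - a.
  rewrite /m mulrCA ger_pMr ?subr_gt0// ler_pdivrMr// mul1r ler_nat.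
  by rewrite !ltnS.
have mc : m @ \oo --> (0 : R).
  rewrite -[X in _ --> X](mulr0 (b - a)); apply: cvgMr.
  have : (@harmonic R) (n + 2)%N @[n --> \oo] --> (0 : R).
    by rewrite (@cvg_shiftn 2 R (@harmonic R)); exact: cvg_harmonic.
  by under eq_fun do rewrite /harmonic addn2.
pose I n := `[a + m n, b - m n]%classic : set R.
have sub n x : I n x -> a < x < b.
  rewrite /I/= in_itv/= => /andP[ax xb].
  by have := m0 n => ?; apply/andP; split; lra.
have Iint n : (\int[lebesgue_measure]_(x in I n) (f x)%:E =
    (F (b - m n) - F (a + m n))%:E)%E.
  have lt : a + m n < b - m n by have := m0 n; have := m3 n => ? ?; lra.
  have inab x : x \in `[a + m n, b - m n] -> a < x < b by exact: sub.
  have dc x : a < x < b -> {for x, continuous F}.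
    move=> /dF dFx; apply: differentiable_continuous; apply/derivable1_diffP.
    by case: dFx.
  rewrite (@continuous_FTC2 R f F)// ?EFinB//.
  - apply: continuous_in_subspaceT => x /set_mem; exact: (fun h => cf x (sub n x h)).
  - split.
    + move=> x; rewrite in_itv/= => /andP[ax xb].
      by have /dF[] : a < x < b by have := m0 n => ?; apply/andP; split; lra.
    + apply: cvg_at_right_filter; apply: dc; apply: inab.
      by rewrite in_itv/= lexx ltW.
    + apply: cvg_at_left_filter; apply: dc; apply: inab.
      by rewrite in_itv/= lexx ltW.
  - move=> x; rewrite in_itv/= => /andP[ax xb].
    have /dF[_] : a < x < b by have := m0 n => ?; apply/andP; split; lra.
    by rewrite derive1E.
have UI : \bigcup_n I n = `]a, b[%classic.
  apply/seteqP; split => [x [n _]|x].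
    by move=> /sub; rewrite /= in_itv.
  rewrite /= in_itv/= => /andP[ax xb].
  have /cvgr0Pnorm_lt h := mc.
  have xa0 : 0 < x - a by rewrite subr_gt0.
  have bx0 : 0 < b - x by rewrite subr_gt0.
  have [N _ /(_ N (leqnn N))] := filterI (h _ xa0) (h _ bx0).
  move=> [/=]; rewrite gtr0_norm// => h1 h2; exists N => //.
  by rewrite /I/= in_itv/=; apply/andP; split; lra.
have mf n : measurable_fun (I n) (fun x => (f x)%:E).
  apply/measurable_EFinP; apply: subspace_continuous_measurable_fun; first exact: measurable_itv.
  by apply: continuous_in_subspaceT => x /set_mem xI; exact: (cf x (sub n x xI)).
have := @ge0_nondecreasing_set_cvg_integral _ (measurableTypeR R) R I (fun x => (f x)%:E) lebesgue_measure.
rewrite UI => cv.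
apply/esym; apply: (cvg_unique _ _ (cv _ _ mf _)) => //.
- apply: (@cvg_trans _ ((fun n => (F (b - m n) - F (a + m n))%:E) @ \oo)).
    by apply: near_eq_cvg; near=> n; exact/esym/Iint.
  apply: cvg_EFin; first by near=> n.
  apply: cvgB.
    move/cvg_at_leftP : Fb; apply; split => [n|]; first by rewrite ltrBlDr ltrDl.
    by rewrite -[X in _ --> X]subr0; apply: cvgB => //; exact: cvg_cst.
  move/cvg_at_rightP : Fa; apply; split => [n|]; first by rewrite ltrDl.
  by rewrite -[X in _ --> X]addr0; apply: cvgD => //; exact: cvg_cst.
- move=> n k nk; apply/subsetPset => x; rewrite /I/= !in_itv/= => /andP[h1 h2].
  by have := mle _ _ nk => ?; apply/andP; split; lra.
- by move=> n; exact: measurable_itv.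
- by move=> n x /sub /f0; rewrite lee_fin.
Unshelve. all: by end_near. Qed.

(** * Integrals of power functions *)

Section power_calculus.
Context {R : realType}.
Implicit Types p q r s t u v c : R.

Lemma continuous_powR p s : 0 < s -> {for s, continuous (fun u => u `^ p)}.
Proof.
move=> s0; apply: differentiable_continuous; apply/derivable1_diffP.
by case: (is_derive1_powR p s0).
Qed.

Lemma cvg_powR_right p s : 0 < p -> 0 <= s -> u `^ p @[u --> s^'+] --> s `^ p.
Proof.
move=> p0; rewrite le_eqVlt => /predU1P[<-|s0].
  by rewrite powR0 ?gt_eqF//; exact: powR_cvg0.
by apply: cvg_at_right_filter; exact: continuous_powR.
Qed.

Lemma cvg_powR_left p s : 0 < s -> u `^ p @[u --> s^'-] --> s `^ p.
Proof. by move=> s0; apply: cvg_at_left_filter; exact: continuous_powR. Qed.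

Lemma is_derive_powR_powRD p q c s : 0 < s -> 0 <= c ->
  is_derive s 1 (fun u => (u `^ p + c) `^ q)
    (q * p * s `^ (p - 1) * (s `^ p + c) `^ (q - 1)).
Proof.
move=> s0 c0.
have spc : 0 < s `^ p + c by rewrite ltr_wpDr// powR_gt0.
have ds := is_derive1_powR p s0.
have d1 : is_derive s 1 (fun u => u `^ p + c) (p * s `^ (p - 1)).
  by apply: is_derive_eq; rewrite addr0.
apply: (is_derive_eq (@is_derive1_comp R (fun x => x `^ q)
  (fun u => u `^ p + c) s _ _ (is_derive1_powR q spc) d1)).
by rewrite /GRing.scale/=; ring.
Qed.

(** Layer-cake form of [s `^ p]: at [s = Num.min s1 s2] it exhibits the kernel
    [Num.min s1 s2 `^ p] as a superposition of squares. *)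
Lemma integral_powR p s : 0 < p -> 0 <= s ->
  (\int[lebesgue_measure]_(u in `]0%R, s[) (p * u `^ (p - 1))%:E = (s `^ p)%:E)%E.
Proof.
move=> p0; rewrite le_eqVlt => /predU1P[<-|s0].
  by rewrite set_itvoo0 integral_set0 powR0 ?gt_eqF.
rewrite (@ge0_FTC_oo R _ (fun u => u `^ p))//.
- by rewrite powR0 ?gt_eqF// subr0.
- by move=> x /andP[x0 _]; rewrite mulr_ge0 ?powR_ge0// ltW.
- by move=> x /andP[x0 _]; apply: cvgMr; exact: continuous_powR.
- by move=> x /andP[x0 _]; by have [] := is_derive1_powR p x0.
- exact: cvg_powR_right.
- exact: cvg_powR_left.
Qed.

(** The same for the boundary term at [T] that the kernel [`|t - s| `^ r] leaves
    in [integral2_powRB_diag]. *)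
Lemma integral_powRB p s T : 0 < p -> 0 <= s <= T ->
  (\int[lebesgue_measure]_(u in `]0%R, s[) (p * (T - u) `^ (p - 1))%:E =
   (T `^ p - (T - s) `^ p)%:E)%E.
Proof.
move=> p0 /andP[]; rewrite le_eqVlt => /predU1P[<- _|s0 sT].
  by rewrite set_itvoo0 integral_set0 subr0 subrr.
have cT x : x < T -> {for x, continuous (fun u => T - u)}.
  by move=> _; apply: cvgB; [exact: cvg_cst|exact: cvg_id].
rewrite (@ge0_FTC_oo R _ (fun u => - (T - u) `^ p))//.
- by rewrite subr0 opprK addrC.
- move=> x /andP[x0 xs]; rewrite mulr_ge0 ?powR_ge0// ltW//.
- move=> x /andP[x0 xs]; apply: cvgMr.
  apply: (@continuous_comp _ _ _ (fun u => T - u) (fun u => u `^ (p - 1))).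
    by apply: cT; lra.
  by apply: continuous_powR; lra.
- move=> x /andP[x0 xs].
  have Tx : 0 < T - x by lra.
  have d1 : is_derive x 1 (fun u => T - u) (-1).
    by apply: is_derive_eq; rewrite add0r mul1r.
  have d2 := @is_derive1_comp R (fun x => x `^ p) (fun u => T - u) x _ _
    (is_derive1_powR p Tx) d1.
  have [? ->] := is_deriveN d2; split => //.
  by rewrite mulrN1 opprK.
- apply: cvgN; apply: cvg_at_right_filter.
  apply: (@continuous_comp _ _ _ (fun u => T - u) (fun u => u `^ p)).
    by apply: cT; lra.
  by apply: continuous_powR; lra.
- apply: cvgN.
  apply/cvg_at_leftP => u [us cu].
  have := @cvg_powR_right p (T - s) p0; rewrite subr_ge0 => /(_ sT).
  move=> /cvg_at_rightP; apply; split => [n|].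
    by rewrite ltrD2l ltrN2.
  by apply: cvgB => //; exact: cvg_cst.
Qed.

Lemma integral_powR_powRD p q s t : 0 < p -> q != 1 -> 0 < t -> 0 <= s ->
  (\int[lebesgue_measure]_(u in `]0%R, s[)
     (p * u `^ (p - 1) * (u `^ p + t `^ p) `^ (q - 2))%:E =
   ((q - 1)^-1 * ((s `^ p + t `^ p) `^ (q - 1) - t `^ (p * (q - 1))))%:E)%E.
Proof.
move=> p0 q1 t0; rewrite le_eqVlt => /predU1P[<-|s0].
  by rewrite set_itvoo0 integral_set0 powR0 ?gt_eqF// add0r powRrM subrr mulr0.
have tp0 : 0 < t `^ p by rewrite powR_gt0.
have q10 : q - 1 != 0 by rewrite subr_eq0.
have cu x r : 0 < x ->
    {for x, continuous (fun u => (u `^ p + t `^ p) `^ r)}.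
  move=> x0; apply: differentiable_continuous; apply/derivable1_diffP.
  by case: (is_derive_powR_powRD p r x0 (ltW tp0)).
rewrite (@ge0_FTC_oo R _ (fun u => (q - 1)^-1 * (u `^ p + t `^ p) `^ (q - 1)))//.
- by rewrite powR0 ?gt_eqF// add0r -powRrM -[in LHS]mulrBr.
- move=> x /andP[x0 xs]; rewrite mulr_ge0 ?powR_ge0// mulr_ge0 ?powR_ge0//.
  exact: ltW.
- move=> x /andP[x0 xs]. apply: cvgM; last exact: cu.
  by apply: cvgMr; exact: continuous_powR.
- move=> x /andP[x0 xs].
  have [? ->] :=
    is_deriveZ (q - 1)^-1 (is_derive_powR_powRD p (q - 1) x0 (ltW tp0)).
  split => //.
  rewrite /GRing.scale/= -!mulrA mulKf// (_ : q - 1 - 1 = q - 2)//; ring.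
- apply: cvgMr; rewrite powR0 ?gt_eqF// add0r.
  apply: (@cvg_comp _ _ _ (fun u => u `^ p + t `^ p) (fun u => u `^ (q - 1))
    _ (nbhs (t `^ p))); last exact: continuous_powR.
  have : u `^ p + t `^ p @[u --> (0 : R)^'+] --> 0 + t `^ p.
    by apply: cvgD; [exact: powR_cvg0|exact: cvg_cst].
  by rewrite add0r.
- by apply: cvgMr; apply: cvg_at_left_filter; exact: cu.
Qed.

(** Up to the factor [q * (q - 1)] the integrand is the mixed derivative of
    [(u `^ p + v `^ p) `^ q], so that two integrations leave the values of the
    latter at the corners of the rectangle.  With this factor moved to the other
    side the integrand is nonnegative for every [q], which gives a meaning to the
    integrals although it may be unbounded near the axes. *)
Lemma integral2_powR_powRD p q s t : 0 < p -> 0 < q -> q != 1 ->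
  0 <= s -> 0 <= t ->
  (\int[lebesgue_measure]_(u in `]0%R, s[) \int[lebesgue_measure]_(v in `]0%R, t[)
     (p * u `^ (p - 1) * (p * v `^ (p - 1) * (v `^ p + u `^ p) `^ (q - 2)))%:E =
   ((q * (q - 1))^-1 *
    ((s `^ p + t `^ p) `^ q - s `^ (p * q) - t `^ (p * q)))%:E)%E.
Proof.
move=> p0 q0 q1; rewrite le_eqVlt => /predU1P[<- _|s0].
  rewrite set_itvoo0 integral_set0 !powR0 ?gt_eqF// ?mulr_gt0//.
  by rewrite add0r subr0 powRrM subrr mulr0.
rewrite le_eqVlt => /predU1P[<-|t0].
  rewrite set_itvoo0; under eq_integral do rewrite integral_set0.
  rewrite integral0 !powR0 ?gt_eqF// ?mulr_gt0//.
  by rewrite addr0 subr0 powRrM subrr mulr0.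
have tp0 : 0 < t `^ p by rewrite powR_gt0.
have q10 : q - 1 != 0 by rewrite subr_eq0.
have qN0 : q != 0 by rewrite gt_eqF.
have cu x r : 0 < x ->
    {for x, continuous (fun u => (u `^ p + t `^ p) `^ r)}.
  move=> x0; apply: differentiable_continuous; apply/derivable1_diffP.
  by case: (is_derive_powR_powRD p r x0 (ltW tp0)).
pose g u := (q - 1)^-1 * ((u `^ p + t `^ p) `^ (q - 1) - u `^ (p * (q - 1))).
have inner u : 0 < u -> (\int[lebesgue_measure]_(v in `]0%R, t[)
     (p * v `^ (p - 1) * (v `^ p + u `^ p) `^ (q - 2))%:E = (g u)%:E)%E.
  move=> u0; rewrite (integral_powR_powRD p0 q1 u0 (ltW t0)).
  by rewrite /g (addrC (t `^ p)).
have g0 u : 0 < u -> 0 <= g u.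
  move=> u0; rewrite -lee_fin -inner//; apply: integral_ge0 => v _.
  by rewrite lee_fin !mulr_ge0 ?powR_ge0// ltW.
transitivity (\int[lebesgue_measure]_(u in `]0%R, s[)
    (p * u `^ (p - 1) * g u)%:E)%E.
  apply: eq_integral => u; rewrite inE/= in_itv/= => /andP[u0 _].
  rewrite EFinM -inner// -ge0_integralZl_EFin//.
  - by move=> v _; rewrite lee_fin !mulr_ge0 ?powR_ge0// ltW.
  - apply/measurable_EFinP; apply: measurable_funM.
      by apply: measurable_funM => //; exact: measurable_funTS (measurable_powR _).
    apply: (measurableT_comp (measurable_powR _)) => //=.
    apply: measurable_funD => //.
    by apply: measurable_funTS; exact: measurable_powR.
  - by rewrite mulr_ge0 ?powR_ge0// ltW.
rewrite (@ge0_FTC_oo R _ (fun u => (q * (q - 1))^-1 *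
    ((u `^ p + t `^ p) `^ q - u `^ (p * q))))//.
- congr (_%:E); rewrite !powR0 ?gt_eqF// ?mulr_gt0//.
  by rewrite add0r subr0 -powRrM -mulrBr addrAC.
- by move=> u /andP[u0 _]; rewrite mulr_ge0 ?g0// mulr_ge0 ?powR_ge0// ltW.
- move=> x /andP[x0 xs]; apply: cvgM.
    by apply: cvgMr; exact: continuous_powR.
  by apply: cvgMr; apply: cvgB; [exact: cu|exact: continuous_powR].
- move=> x /andP[x0 xs].
  have [? ->] := is_deriveZ (q * (q - 1))^-1
    (is_deriveB (is_derive_powR_powRD p q x0 (ltW tp0))
                (is_derive1_powR (p * q) x0)).
  split => //; rewrite /GRing.scale/= /g.
  have -> : x `^ (p * q - 1) = x `^ (p - 1) * x `^ (p * (q - 1)).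
    rewrite -powRD; first by congr (_ `^ _); ring.
    by rewrite (gt_eqF x0) implybT.
  by field; rewrite q10.
- apply: cvgMr; apply: cvgB.
    rewrite powR0 ?gt_eqF// add0r.
    apply: (@cvg_comp _ _ _ (fun u => u `^ p + t `^ p) (fun u => u `^ q)
      _ (nbhs (t `^ p))); last exact: continuous_powR.
    have : u `^ p + t `^ p @[u --> (0 : R)^'+] --> 0 + t `^ p.
      by apply: cvgD; [exact: powR_cvg0|exact: cvg_cst].
    by rewrite add0r.
  by apply: cvg_powR_right => //; rewrite mulr_gt0.
- apply: cvgMr; apply: cvgB; last exact: cvg_powR_left.
  by apply: cvg_at_left_filter; exact: cu.
Qed.

Lemma integral_powRB_diag r u t T : u < t <= T -> r < 1 ->
  (\int[lebesgue_measure]_(v in `]t, T[) ((1 - r) * (v - u) `^ (r - 2))%:E =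
   ((t - u) `^ (r - 1) - (T - u) `^ (r - 1))%:E)%E.
Proof.
move=> /andP[ut]; rewrite le_eqVlt => /predU1P[->|tT] r1.
  by rewrite set_itvoo0 integral_set0 subrr.
have d x : u < x -> is_derive x 1 (fun v => - (v - u) `^ (r - 1))
    ((1 - r) * (x - u) `^ (r - 2)).
  move=> ux; have xu : 0 < x - u by rewrite subr_gt0.
  have d1 : is_derive x 1 (fun v => v - u) 1.
    by apply: is_derive_eq; rewrite subr0.
  apply: (is_derive_eq (is_deriveN (@is_derive1_comp R (fun x => x `^ (r - 1))
    (fun v => v - u) x _ _ (is_derive1_powR (r - 1) xu) d1))).
  by rewrite mulr1 -mulNr opprB (_ : r - 1 - 1 = r - 2)//; ring.
have c x p : u < x -> {for x, continuous (fun v => (v - u) `^ p)}.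
  move=> ux; apply: (@continuous_comp _ _ _ (fun v => v - u) (fun v => v `^ p)).
    by apply: cvgB; [exact: cvg_id|exact: cvg_cst].
  by apply: continuous_powR; rewrite subr_gt0.
rewrite (@ge0_FTC_oo R _ (fun v => - (v - u) `^ (r - 1)))//.
- by rewrite opprK addrC.
- by move=> x /andP[tx _]; rewrite mulr_ge0 ?powR_ge0// subr_ge0 ltW.
- by move=> x /andP[tx _]; apply: cvgMr; apply: c; exact: lt_trans tx.
- by move=> x /andP[tx _]; have [] := d x (lt_trans ut tx).
- by apply: cvgN; apply: cvg_at_right_filter; exact: c.
- by apply: cvgN; apply: cvg_at_left_filter; apply: c; exact: lt_trans tT.
Qed.

(** The integrand, the mixed derivative of [(v - u) `^ r], is not integrable along
    a segment of the diagonal.  The rectangle [`]0, s[ x ]t, T[] touches the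
    diagonal at most at a corner, where the singularity is still integrable. *)
Lemma integral2_powRB_diag r s t T : 0 < r < 1 -> 0 <= s <= t -> t <= T ->
  (\int[lebesgue_measure]_(u in `]0%R, s[) \int[lebesgue_measure]_(v in `]t, T[)
     (r * (1 - r) * (v - u) `^ (r - 2))%:E =
   (t `^ r - (t - s) `^ r - (T `^ r - (T - s) `^ r))%:E)%E.
Proof.
move=> /andP[r0 r1] /andP[s0 st] tT.
transitivity (\int[lebesgue_measure]_(u in `]0%R, s[)
    ((r * (t - u) `^ (r - 1))%:E - (r * (T - u) `^ (r - 1))%:E))%E.
  apply: eq_integral => u; rewrite inE/= in_itv/= => /andP[u0 us].
  rewrite -EFinB -mulrBr EFinM -integral_powRB_diag ?tT ?andbT//; last first.
    exact: lt_le_trans st.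
  rewrite -ge0_integralZl_EFin//; first by apply: eq_integral => v _; rewrite -EFinM mulrA.
  - by move=> v _; rewrite lee_fin mulr_ge0 ?powR_ge0// subr_ge0 ltW.
  - apply/measurable_EFinP; apply: measurable_funM => //.
    apply: (measurableT_comp (measurable_powR _)) => //=.
    exact: measurable_funB.
  - exact: ltW.
have int c : s <= c -> lebesgue_measure.-integrable `]0%R, s[
    (fun u => (r * (c - u) `^ (r - 1))%:E).
  move=> sc; apply/integrableP; split.
    apply/measurable_EFinP; apply: measurable_funM => //.
    apply: (measurableT_comp (measurable_powR _)) => //=.
    exact: measurable_funB.
  under eq_integral => u _.
    rewrite gee0_abs ?lee_fin ?mulr_ge0 ?powR_ge0 ?(ltW r0)//. over.
  by rewrite integral_powRB ?s0// ltry.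
rewrite integralB//=; [|exact: int|by apply: int; exact: le_trans tT].
by rewrite !integral_powRB ?s0// (le_trans st).
Qed.

End power_calculus.

(** * Superpositions of indicators of rectangles *)

Section sigma_finite_product.
Context d1 d2 (T1 : measurableType d1) (T2 : measurableType d2) (R : realType)
  (m1 : {sigma_finite_measure set T1 -> \bar R})
  (m2 : {sigma_finite_measure set T2 -> \bar R}).

(** The product measure under a name that carries its sigma-finiteness, so that
    it can be a factor in Tonelli's theorem in its turn. *)
Definition prod_measure : set (T1 * T2) -> \bar R := (m1 \x m2)%E.

HB.instance Definition _ := Measure.on prod_measure.

Let prod_measure_sigma_finite : sigma_finite [set: T1 * T2] prod_measure.
Proof.
have /sigma_finiteP[F [TF ndF Foo]] := sigma_finiteT m1.
have /sigma_finiteP[G [TG ndG Goo]] := sigma_finiteT m2.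
exists (fun n => F n `*` G n).
  rewrite -setXTT TF TG predeqE => -[x y]; split.
    move=> [/= [n _ Fnx] [k _ Gky]]; exists (maxn n k) => //; split.
    - by move: x Fnx; exact/subsetPset/ndF/leq_maxl.
    - by move: y Gky; exact/subsetPset/ndG/leq_maxr.
  by move=> [n _ [/= Fnx Gny]]; split; exists n.
move=> k; have [? ?] := Foo k; have [? ?] := Goo k.
split; first exact: measurableX.
rewrite /prod_measure product_measure1E// lte_mul_pinfty// ge0_fin_numE//.
Qed.

HB.instance Definition _ := Measure_isSigmaFinite.Build _ _ _ prod_measure
  prod_measure_sigma_finite.

End sigma_finite_product.

Section tonelli_kernel.
Context {R : realType} d (X : measurableType d)
  (mu : {sigma_finite_measure set X -> \bar R}) (w : X -> R)
  (A B : X -> set R) (T : R) (K : R -> R -> R).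
Hypothesis mw : measurable_fun [set: X] w.
Hypothesis w0 : forall x, 0 <= w x.
Let SA := [set z : X * measurableTypeR R | A z.1 z.2].
Let SB := [set z : X * measurableTypeR R | B z.1 z.2].
Hypothesis mA : measurable SA.
Hypothesis mB : measurable SB.
Hypothesis A0T : forall x s, A x s -> 0 <= s <= T.
Hypothesis B0T : forall x s, B x s -> 0 <= s <= T.
Hypothesis KE : forall s t, 0 <= s <= T -> 0 <= t <= T ->
  (\int[mu]_x (w x * \1_(A x) s * \1_(B x) t)%:E = (K s t)%:E)%E.

Let mAx x : measurable (A x : set (measurableTypeR R)).
Proof. by have := measurable_xsection x mA; rewrite xsectionE. Qed.

Let mBx x : measurable (B x : set (measurableTypeR R)).
Proof. by have := measurable_xsection x mB; rewrite xsectionE. Qed.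

(** All the terms are nonnegative, so Tonelli's theorem applies to the triple
    integral over [s], [t] and [x] without any integrability; the inner integral
    over [(s, t)] is then the measure of a rectangle. *)
Lemma integral_kernel (m n : {finite_measure set (measurableTypeR R) -> \bar R}) :
  (\int[m \x n]_(p in `[0%R, T] `*` `[0%R, T]) (K p.1 p.2)%:E =
   \int[mu]_x ((w x)%:E * (m (A x) * n (B x))))%E.
Proof.
pose H (z : (measurableTypeR R * measurableTypeR R) * X) : \bar R :=
  (w z.2 * \1_(A z.2) z.1.1 * \1_(B z.2) z.1.2)%:E.
have mH : measurable_fun setT H.
  apply/measurable_EFinP; apply: measurable_funM; first apply: measurable_funM.
  - exact: measurableT_comp mw measurable_snd.
  - rewrite (_ : (fun _ => _) = \1_SA \o (fun z => (z.2, z.1.1)))//.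
    apply: measurableT_comp; first exact: measurable_indic.
    apply: measurable_fun_pair; first exact: measurable_snd.
    exact: measurableT_comp measurable_fst measurable_fst.
  - rewrite (_ : (fun _ => _) = \1_SB \o (fun z => (z.2, z.1.2)))//.
    apply: measurableT_comp; first exact: measurable_indic.
    apply: measurable_fun_pair; first exact: measurable_snd.
    exact: measurableT_comp measurable_snd measurable_fst.
have H0 z : (0 <= H z)%E by rewrite lee_fin !mulr_ge0.
transitivity (\int[m \x n]_p \int[mu]_x H (p, x))%E.
  rewrite integral_mkcond; apply: eq_integral => -[s t] _.
  rewrite patchE; case: ifPn => [|].
    by rewrite inE/= !in_itv/= => -[s0T t0T]; rewrite -KE.
  rewrite notin_setE/= !in_itv/= => /not_andP st.
  rewrite integral0_eq// => x _; rewrite /H/=.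
  case: st => [sN|tN].
    by rewrite (_ : \1_(A x) s = 0) ?mulr0 ?mul0r// indicE memNset// => /A0T.
  by rewrite (_ : \1_(B x) t = 0) ?mulr0// indicE memNset// => /B0T.
pose mn := prod_measure m n.
transitivity (\int[mu]_x \int[mn]_p H (p, x))%E.
  exact: (fubini_tonelli (m1 := mn) (m2 := mu) H mH H0).
apply: eq_integral => x _; rewrite /H/=.
under eq_integral => p _.
  rewrite -mulrA EFinM (_ : \1_(A x) p.1 * \1_(B x) p.2 = \1_(A x `*` B x) p).
    over.
  by case: p => s t; rewrite !indicE/= in_setX/= -natrM mulnb.
rewrite ge0_integralZl_EFin//; last first.
  by apply/measurable_EFinP; apply: measurable_indic; exact: measurableX.
rewrite integral_indic//; last exact: measurableX.
by rewrite setIT; congr (_ * _)%E; exact: product_measure1E.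
Qed.

Lemma measurable_kernel_section
    (m : {finite_measure set (measurableTypeR R) -> \bar R}) :
  measurable_fun [set: X] (fun x => m (A x)) /\
  measurable_fun [set: X] (fun x => m (B x)).
Proof.
split.
- rewrite (_ : (fun _ => _) = m \o xsection SA).
    exact: measurable_fun_xsection.
  by apply/funext => x /=; rewrite xsectionE.
- rewrite (_ : (fun _ => _) = m \o xsection SB).
    exact: measurable_fun_xsection.
  by apply/funext => x /=; rewrite xsectionE.
Qed.

End tonelli_kernel.

(** * Integration against a product of two signed measures *)

Section pairing_functional.
Context {R : realType} (T : R)
  (nuf nug : {charge set (measurableTypeR R) -> \bar R})
  (Pf Nf Pg Ng : set R) (hf : hahn_decomposition nuf Pf Nf)
  (hg : hahn_decomposition nug Pg Ng).
Implicit Types (K : R -> R -> R) (a v : R).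

Let D : set (measurableTypeR R * measurableTypeR R) := `[0, T] `*` `[0, T].

Let mD : measurable D.
Proof. by apply: measurableX; exact: measurable_itv. Qed.

Let lift K (p : measurableTypeR R * measurableTypeR R) := (K p.1 p.2)%:E.

(** The integrability against the products of Jordan parts excludes the form
    [+oo - oo] in [charge_prod_integral], and makes the pairing linear in [K]. *)
Definition pairing K v :=
  [/\ (jordan_pos hf \x jordan_pos hg)%E.-integrable D (lift K),
      (jordan_pos hf \x jordan_neg hg)%E.-integrable D (lift K),
      (jordan_neg hf \x jordan_pos hg)%E.-integrable D (lift K),
      (jordan_neg hf \x jordan_neg hg)%E.-integrable D (lift K) &
      charge_prod_integral hf hg D (fun p => (K p.1 p.2)%:E) = v%:E].

Lemma pairing_uniq K v1 v2 : pairing K v1 -> pairing K v2 -> v1 = v2.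
Proof. by move=> [_ _ _ _ e1] [_ _ _ _ e2]; apply: EFin_inj; rewrite -e1 -e2. Qed.

Lemma pairing_ext K1 K2 v :
  (forall s t, 0 <= s <= T -> 0 <= t <= T -> K1 s t = K2 s t) ->
  pairing K1 v -> pairing K2 v.
Proof.
move=> e.
have e' : {in D, lift K1 =1 lift K2}.
  by move=> [s t]; rewrite inE /D/= !in_itv/= => -[? ?]; rewrite /lift/= e.
move=> [i1 i2 i3 i4 e1]; split; [exact: eq_integrable i1|exact: eq_integrable i2|
  exact: eq_integrable i3|exact: eq_integrable i4|].
rewrite -e1 /charge_prod_integral; congr (_ - _ - _ + _)%E;
  by apply: eq_integral => p /e'.
Qed.

Lemma pairingZD a K1 K2 v1 v2 : pairing K1 v1 -> pairing K2 v2 ->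
  pairing (fun s t => a * K1 s t + K2 s t) (a * v1 + v2).
Proof.
move=> [i1 i2 i3 i4 e] [j1 j2 j3 j4 e'].
have int (m : {measure set (measurableTypeR R * measurableTypeR R) -> \bar R}) :
    m.-integrable D (lift K1) -> m.-integrable D (lift K2) ->
    m.-integrable D (lift (fun s t => a * K1 s t + K2 s t)) /\
    exists w1 w2, [/\ (\int[m]_(p in D) lift K1 p = w1%:E)%E,
      (\int[m]_(p in D) lift K2 p = w2%:E)%E &
      (\int[m]_(p in D) lift (fun s t => a * K1 s t + K2 s t)%R p =
       (a * w1 + w2)%:E)%E].
  move=> i j; have ai := integrableZl mD a i.
  split; first exact: eq_integrable (integrableD mD ai j).
  exists (fine (\int[m]_(p in D) lift K1 p)), (fine (\int[m]_(p in D) lift K2 p)).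
  rewrite EFinD EFinM !fineK; last 2 first.
    exact: integrable_fin_num.
    exact: integrable_fin_num.
  by split => //; rewrite -integralZl// -integralD.
have [k1 [x1 [y1 [a1 b1 c1]]]] := int _ i1 j1.
have [k2 [x2 [y2 [a2 b2 c2]]]] := int _ i2 j2.
have [k3 [x3 [y3 [a3 b3 c3]]]] := int _ i3 j3.
have [k4 [x4 [y4 [a4 b4 c4]]]] := int _ i4 j4.
split => //.
move: e e'; rewrite /charge_prod_integral.
rewrite -!/(lift _).
move: a1 a2 a3 a4 b1 b2 b3 b4 c1 c2 c3 c4; rewrite /lift.
move=> -> -> -> -> -> -> -> -> -> -> -> ->.
rewrite -!EFinB -!EFinD => -[<-] [<-]; congr (_%:E); ring.
Qed.

Lemma pairing_bounded K (M : R) :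
  measurable_fun [set: measurableTypeR R * measurableTypeR R]
    (fun p => K p.1 p.2) ->
  (forall s t, 0 <= s <= T -> 0 <= t <= T -> `|K s t| <= M) ->
  exists v, pairing K v.
Proof.
move=> mK KM.
have int (m n : {finite_measure set (measurableTypeR R) -> \bar R}) :
    (m \x n)%E.-integrable D (lift K).
  apply: (@measurable_bounded_integrable _ _ _ (m \x n)%E (fun p => K p.1 p.2) D mD).
  - suff h : ((m \x n)%E D < +oo)%E by exact: h.
    suff -> : (m \x n)%E D = (m `[0%R, T]%classic * n `[0%R, T]%classic)%E.
      by rewrite ltey_eq fin_numM// fin_num_measure.
    by apply: product_measure1E; exact: measurable_itv.
  - exact: measurable_funTS.
  - exists M; split; first exact: num_real.
    move=> x Mx [s t]; rewrite /D/= !in_itv/= => -[? ?].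
    by rewrite (le_trans _ (ltW Mx))// KM.
have fin (m n : {finite_measure set (measurableTypeR R) -> \bar R}) :
    (\int[m \x n]_(p in D) lift K p)%E \is a fin_num.
  by apply: integrable_fin_num => //; exact: int.
exists (fine (charge_prod_integral hf hg D (fun p => (K p.1 p.2)%:E))); split.
- exact: int.
- exact: int.
- exact: int.
- exact: int.
- rewrite fineK//.
  have aux (a b c d : \bar R) : a \is a fin_num -> b \is a fin_num ->
      c \is a fin_num -> d \is a fin_num -> (a - b - c + d)%E \is a fin_num.
    by rewrite !fin_numD !fin_numN => -> -> -> ->.
  have f1 := fin (jordan_pos hf) (jordan_pos hg).
  have f2 := fin (jordan_pos hf) (jordan_neg hg).
  have f3 := fin (jordan_neg hf) (jordan_pos hg).
  have f4 := fin (jordan_neg hf) (jordan_neg hg).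
  exact: aux f1 f2 f3 f4.
Qed.

Lemma jordan_decomp_fine (nu : {charge set (measurableTypeR R) -> \bar R})
    (P N : set R) (h : hahn_decomposition nu P N) (A : set R) :
  measurable (A : set (measurableTypeR R)) ->
  fine (nu A) = fine (jordan_pos h A) - fine (jordan_neg h A).
Proof.
move=> mA; rewrite (jordan_decomp h mA) /cadd/= cscaleN1 -fineB//.
  exact: (fin_num_measure (jordan_pos h)).
exact: (fin_num_measure (jordan_neg h)).
Qed.

(** Since [K] is bounded, it is integrable for the four finite product measures;
    by [integral_kernel] so are the corresponding functions of [x], and their
    signed combination regroups into [nuf (A x) * nug (B x)].  The integrability
    in the conclusion is obtained for free in this way, even where [w] is
    singular. *)
Lemma pairing_kernel d (X : measurableType d)
    (mu : {sigma_finite_measure set X -> \bar R}) (w : X -> R)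
    (A B : X -> set R) K (M : R) :
  measurable_fun [set: X] w -> (forall x, 0 <= w x) ->
  measurable [set z : X * measurableTypeR R | A z.1 z.2] ->
  measurable [set z : X * measurableTypeR R | B z.1 z.2] ->
  (forall x s, A x s -> 0 <= s <= T) -> (forall x s, B x s -> 0 <= s <= T) ->
  (forall s t, 0 <= s <= T -> 0 <= t <= T ->
    (\int[mu]_x (w x * \1_(A x) s * \1_(B x) t)%:E = (K s t)%:E)%E) ->
  measurable_fun [set: measurableTypeR R * measurableTypeR R]
    (fun p => K p.1 p.2) ->
  (forall s t, 0 <= s <= T -> 0 <= t <= T -> `|K s t| <= M) ->
  exists v, [/\ pairing K v,
    mu.-integrable [set: X]
      (fun x => (w x * (fine (nuf (A x)) * fine (nug (B x))))%:E) &
    (\int[mu]_x (w x * (fine (nuf (A x)) * fine (nug (B x))))%:E = v%:E)%E].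
Proof.
move=> mw w0 mA mB A0T B0T KE mK KM.
have [v jv] := pairing_bounded mK KM; exists v.
have mAx x : measurable (A x : set (measurableTypeR R)).
  by have := measurable_xsection x mA; rewrite xsectionE.
have mBx x : measurable (B x : set (measurableTypeR R)).
  by have := measurable_xsection x mB; rewrite xsectionE.
pose I (m n : {finite_measure set (measurableTypeR R) -> \bar R}) x :=
  w x * (fine (m (A x)) * fine (n (B x))).
have IE (m n : {finite_measure set (measurableTypeR R) -> \bar R}) :
    (\int[mu]_x (I m n x)%:E = \int[m \x n]_(p in D) lift K p)%E.
  rewrite /lift (integral_kernel mw w0 mA mB A0T B0T KE).
  apply: eq_integral => x _; rewrite /I EFinM EFinM !fineK//;
    exact: fin_num_measure.
have Iint (m n : {finite_measure set (measurableTypeR R) -> \bar R}) :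
    (m \x n)%E.-integrable D (lift K) ->
    mu.-integrable [set: X] (fun x => (I m n x)%:E).
  move=> iK; have mI : measurable_fun [set: X] (I m n).
    apply: measurable_funM => //; apply: measurable_funM;
      apply: measurableT_comp => //.
      by have [] := measurable_kernel_section mA mB m.
    by have [] := measurable_kernel_section mA mB n.
  apply/integrableP; split; first exact/measurable_EFinP.
  under eq_integral => x _.
    rewrite gee0_abs ?lee_fin ?mulr_ge0 ?fine_ge0 ?measure_ge0//. over.
  by rewrite IE; exact: integrable_lty.
have [i1 i2 i3 i4 e] := jv.
have k1 := Iint (jordan_pos hf) (jordan_pos hg) i1.
have k2 := Iint (jordan_pos hf) (jordan_neg hg) i2.
have k3 := Iint (jordan_neg hf) (jordan_pos hg) i3.
have k4 := Iint (jordan_neg hf) (jordan_neg hg) i4.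
have sumE x : (w x * (fine (nuf (A x)) * fine (nug (B x))))%:E =
    ((I (jordan_pos hf) (jordan_pos hg) x)%:E
     - (I (jordan_pos hf) (jordan_neg hg) x)%:E
     - (I (jordan_neg hf) (jordan_pos hg) x)%:E
     + (I (jordan_neg hf) (jordan_neg hg) x)%:E)%E.
  rewrite -!EFinB -EFinD /I; congr (_%:E).
  by rewrite (jordan_decomp_fine hf)// (jordan_decomp_fine hg)//; ring.
have k12 := integrableB measurableT k1 k2.
have k123 := integrableB measurableT k12 k3.
have k1234 := integrableD measurableT k123 k4.
split => //.
  by apply: eq_integrable k1234 => // x _; rewrite sumE.
under eq_integral do rewrite sumE.
rewrite integralD// integralB// integralB//.
by rewrite (IE (jordan_pos hf) (jordan_pos hg)) (IE (jordan_pos hf) (jordan_neg hg))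
  (IE (jordan_neg hf) (jordan_pos hg)) (IE (jordan_neg hf) (jordan_neg hg)).
Qed.

End pairing_functional.

(** * The measure of a bounded monotone function *)

Section right_limit.
Context {R : realType} (P : R -> R).
Hypothesis ndP : {homo P : x y / x <= y}.

Definition right_limit (x : R) : R := lim (P y @[y --> x^'+]).

Lemma cvg_right_limit x : P y @[y --> x^'+] --> right_limit x.
Proof.
apply: nondecreasing_at_right_is_cvgr.
  by near=> y; move=> ? ? _ _; exact: ndP.
near=> y; exists (P x) => _ [z + <-]; rewrite /= in_itv/= => /andP[xz _].
exact/ndP/ltW.
Unshelve. all: by end_near. Qed.

Lemma le_right_limit x : P x <= right_limit x.
Proof.
apply: limr_ge; first exact: cvg_right_limit.
near=> y; apply/ndP/ltW; near: y; exact: nbhs_right_gt.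
Unshelve. all: by end_near. Qed.

Lemma right_limit_le x y : x < y -> right_limit x <= P y.
Proof.
move=> xy; apply: limr_le; first exact: cvg_right_limit.
near=> z; apply/ndP/ltW; near: z; exact: nbhs_right_lt.
Unshelve. all: by end_near. Qed.

Lemma right_limit_nondecreasing : {homo right_limit : x y / x <= y}.
Proof.
move=> x y; rewrite le_eqVlt => /predU1P[->//|xy].
exact: le_trans (right_limit_le xy) (le_right_limit y).
Qed.

Lemma right_limit_right_continuous x :
  right_limit y @[y --> x^'+] --> right_limit x.
Proof.
apply/cvgrPdist_le => e e0.
have /cvgrPdist_le Px := @cvg_right_limit x.
have {}Px := Px e e0.
near x^'+ => y.
have xy : x < y by near: y; exact: nbhs_right_gt.
have Py : P y <= right_limit x + e.
  have : `|right_limit x - P y| <= e by near: y.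
  by rewrite ler_distlC lerBlDr => /andP[].
near=> z.
have xz : x < z by near: z; exact: nbhs_right_gt.
have zy : z < y by near: z; exact: nbhs_right_lt.
have h1 := right_limit_nondecreasing (ltW xz).
have h2 := right_limit_le zy.
by rewrite distrC ger0_norm ?subr_ge0//; lra.
Unshelve. all: by end_near. Qed.

(** The value at a point lies between the two one-sided limits; where it differs
    from the right one, the function jumps. *)
Lemma right_limit_neq_countable a b :
  countable [set x | x \in (`]a, b[) /\ right_limit x != P x].
Proof.
have ndab : {in `[a, b] &, nondecreasing_fun P} by move=> ? ? _ _; exact: ndP.
apply: sub_countable (discontinuity_countable ndab).
apply: subset_card_le => x [xab /negP xP]; split => //.
have cl : cvg (P y @[y --> x^'-]).
  apply: nondecreasing_at_left_is_cvgr.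
    by near=> y; move=> ? ? _ _; exact: ndP.
  near=> y; exists (P x) => _ [z + <-]; rewrite /= in_itv/= => /andP[_ zx].
  exact/ndP/ltW.
split => //; first by apply/cvg_ex; exists (right_limit x); exact: cvg_right_limit.
apply/negP => /eqP lr; apply: xP; rewrite eq_le le_right_limit andbT.
rewrite /right_limit -lr; apply: limr_le => //.
near=> y; apply/ndP/ltW; near: y; exact: nbhs_left_lt.
Unshelve. all: by end_near. Qed.

(** Passing to right limits makes the function right-continuous without changing
    the measure that it defines; boundedness makes this measure finite. *)
Lemma right_limit_measure (C : R) : (forall x, `|P x| <= C) ->
  exists m : {finite_measure set (measurableTypeR R) -> \bar R},
    forall a b, a <= b ->
      m `]a, b]%classic = (right_limit b - right_limit a)%:E.
Proof.
move=> PC.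
have LC x : `|right_limit x| <= C.
  have hx := PC x; have hx1 := PC (x + 1).
  have := le_right_limit x; have := @right_limit_le x (x + 1).
  rewrite ltrDl ltr01 => /(_ isT).
  move: hx hx1; rewrite !ler_norml => /andP[? ?] /andP[? ?] ? ?.
  by apply/andP; split; lra.
pose F : cumulative R R := HB.pack right_limit
  (isCumulative.Build R _ R right_limit right_limit_nondecreasing
    right_limit_right_continuous).
pose m0 := lebesgue_stieltjes_measure F.
have mE a b : a <= b -> m0 `]a, b]%classic = (right_limit b - right_limit a)%:E.
  move=> ab; rewrite /m0 /lebesgue_stieltjes_measure /measure_extension.
  rewrite measurable_mu_extE/=; last exact: is_ocitv.
  by rewrite wlength_itv_bnd.
have mT : (m0 setT < +oo)%E.
  apply: (@le_lt_trans _ _ (C + C)%:E); last exact: ltry.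
  pose I n : set R := `]- (n%:R), n%:R]%classic.
  have cI : m0 (I n) @[n --> \oo] --> m0 (\bigcup_n I n).
    apply: nondecreasing_cvg_mu; rewrite /I//; first exact: bigcup_measurable.
    by move=> *; apply/subsetPset/subset_itv; rewrite leBSide/= ?lerN2 ler_nat.
  have := cI; rewrite /I bigcup_itvT => {}cI.
  rewrite -(cvg_lim _ cI)//; apply: lime_le; first by apply/cvg_ex; eexists; exact: cI.
  near=> n; rewrite mE; last by rewrite ge0_cp.
  have := LC n%:R; have := LC (- n%:R).
  by rewrite lee_fin !ler_norml => /andP[? ?] /andP[? ?]; lra.
pose m : {finite_measure set (measurableTypeR R) -> \bar R} :=
  HB.pack m0 (Measure_isFinite.Build _ _ _ m0 (lty_fin_num_fun mT)).
by exists m.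
Unshelve. all: by end_near. Qed.

End right_limit.

(** What the computation of pairings needs to know about the signed measure [nu]
    of [f].  The set [E] holds the jumps of [f]; there the measure sees one-sided
    limits of [f] instead of its values.  Because [nu] of these intervals is only
    ever integrated against Lebesgue measure, a null set of exceptions is
    harmless. *)
Definition stieltjes_data (R : realType) (T : R) (f : R -> R)
    (nu : {charge set (measurableTypeR R) -> \bar R}) (E : set R) : Prop :=
  [/\ exists C : R, forall x, `|(f \_ `[0, T]) x| <= C,
      measurable_fun [set: measurableTypeR R] (f \_ `[0, T]),
      measurable (E : set (measurableTypeR R)) /\ lebesgue_measure E = 0%E,
      fine (nu `[0, T]%classic) = 0 &
      forall u, 0 < u < T -> ~ E u ->
        fine (nu `]u, T]%classic) = - f u /\
        forall v, u <= v < T -> ~ E v -> fine (nu `]u, v]%classic) = f v - f u].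

(** * The signed measure of a function of bounded variation *)

Section bounded_variation_charge.
Context {R : realType} (T : R) (f : R -> R).
Hypothesis T0 : 0 < T.
Hypothesis bvf : bounded_variation 0 T f.

(** The positive and the negative variation are monotone on [0, T] only.
    Continuing both by the same constants, [- C] on the left and [C] on the right,
    keeps them monotone and makes their difference vanish outside [0, T]. *)
Lemma bounded_variation_decomposition : exists P Q : R -> R, exists C : R,
  [/\ {homo P : x y / x <= y}, {homo Q : x y / x <= y},
      forall x, `|P x| <= C, forall x, `|Q x| <= C &
      f \_ `[0, T] = (fun x => P x - Q x)].
Proof.
pose p := fine \o pos_tv 0 f; pose q := fine \o neg_tv 0 f.
have ndq : {in `[0, T] &, nondecreasing_fun q} := fine_neg_tv_nondecreasing bvf.
have ndp : {in `[0, T] &, nondecreasing_fun p} :=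
  fine_neg_tv_nondecreasing (bounded_variationN bvf).
have fE : {in `[0, T], f =1 p \- q} := bounded_variation_pos_neg_tvE bvf.
pose C := `|p 0| + `|p T| + `|q 0| + `|q T|.
have bnd (g : R -> R) : {in `[0, T] &, nondecreasing_fun g} -> `|g 0| + `|g T| <= C ->
    forall x : R, 0 <= x <= T -> - C <= g x <= C.
  move=> ndg gC x /andP[x0 xT].
  have h0 : g 0 <= g x by apply: ndg => //; rewrite in_itv/= ?lexx ?x0 ?xT// ltW.
  have h1 : g x <= g T by apply: ndg => //; rewrite in_itv/= ?lexx ?x0 ?xT// ltW.
  have := ler_norm (- g 0); have := ler_norm (g T); rewrite normrN.
  have := normr_ge0 (g 0); have := normr_ge0 (g T) => ? ? ? ?.
  by apply/andP; split; lra.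
pose ext (g : R -> R) (x : R) : R := if x < 0 then - C else if x <= T then g x else C.
have C0 : 0 <= C by rewrite /C !addr_ge0.
have extC (g : R -> R) : (forall x : R, 0 <= x <= T -> - C <= g x <= C) ->
    forall x, - C <= ext g x <= C.
  move=> gC x; rewrite /ext; case: (ltP x 0) => x0; first by apply/andP; split; lra.
  by case: (leP x T) => xT; [apply: gC; rewrite x0|apply/andP; split; lra].
have extnd (g : R -> R) : (forall x : R, 0 <= x <= T -> - C <= g x <= C) ->
    {in `[0, T] &, nondecreasing_fun g} -> {homo ext g : x y / x <= y}.
  move=> gC ndg x y xy; have := extC _ gC y; have := extC _ gC x.
  rewrite /ext; case: (ltP x 0) => x0.
    by case: (ltP y 0) => y0 //; move=> ? /andP[].
  rewrite (ltNge y) (le_trans x0 xy)/=; case: (leP x T) => xT.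
    case: (leP y T) => yT; last by move=> /andP[].
    by move=> _ _; apply: ndg => //; rewrite in_itv/= ?x0 ?xT ?yT ?(le_trans x0).
  by rewrite (leNgt y) (lt_le_trans xT xy).
have bp := bnd p ndp; have bq := bnd q ndq.
have {}bp : forall x : R, 0 <= x <= T -> - C <= p x <= C.
  apply: bp; rewrite /C; have := normr_ge0 (q 0); have := normr_ge0 (q T).
  by move=> ? ?; lra.
have {}bq : forall x : R, 0 <= x <= T -> - C <= q x <= C.
  apply: bq; rewrite /C; have := normr_ge0 (p 0); have := normr_ge0 (p T).
  by move=> ? ?; lra.
exists (ext p), (ext q), C; split.
- exact: extnd.
- exact: extnd.
- by move=> x; rewrite ler_norml extC.
- by move=> x; rewrite ler_norml extC.
- apply/funext => x; rewrite patchE /ext; case: ifPn.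
    rewrite inE/= in_itv/= => /andP[x0 xT]; rewrite ltNge x0/= xT.
    by rewrite fE// in_itv/= x0.
  rewrite notin_setE/= in_itv/= => /negP; rewrite negb_and -!ltNge.
  case: (ltP x 0) => x0 /=; first by rewrite subrr.
  by move=> Tx; rewrite leNgt Tx/= subrr.
Qed.

(** The right limit [L] of the continued function vanishes at [T] and on the
    negative axis.  The former turns [nu `]u, T]] into [- f u]; both together
    leave no mass on [0, T]. *)
Lemma bounded_variation_stieltjes :
  exists (nu : {charge set (measurableTypeR R) -> \bar R}) (E : set R),
    lebesgue_stieltjes_charge (f \_ `[0, T]) nu /\ stieltjes_data T f nu E.
Proof.
have [P [Q [C [ndP ndQ PC QC fE]]]] := bounded_variation_decomposition.
have [m mE] := right_limit_measure ndP PC.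
have [n nE] := right_limit_measure ndQ QC.
pose nu : {charge set (measurableTypeR R) -> \bar R} :=
  cadd (charge_of_finite_measure m) (copp (charge_of_finite_measure n)).
pose L x := right_limit P x - right_limit Q x.
have cL x : (f \_ `[0, T]) y @[y --> x^'+] --> L x.
  by rewrite fE; apply: cvgB; exact: cvg_right_limit.
have nuE A : nu A = (m A - n A)%E by [].
have nuab a b : a <= b -> nu `]a, b]%classic = (L b - L a)%:E.
  by move=> ab; rewrite nuE mE// nE// -EFinB; congr (_%:E); rewrite /L; ring.
pose N : set R := [set x | x \in (`]0, T[) /\ right_limit P x != P x] `|`
                  [set x | x \in (`]0, T[) /\ right_limit Q x != Q x].
have cN : countable N.
  by rewrite /N -bigcup2E; apply: bigcup_countable => // -[|[|i]] _ //=;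
    exact: right_limit_neq_countable.
have LE u : 0 < u < T -> ~ N u -> L u = f u.
  move=> u0T Nu; have : (f \_ `[0, T]) u = P u - Q u by rewrite fE.
  have u0T' : u \in `]0, T[ by rewrite in_itv.
  rewrite patchE mem_set; last by rewrite /= in_itv/=; move: u0T => /andP[? ?]; rewrite !ltW.
  move=> ->; rewrite /L; congr (_ - _); apply/eqP/negPn/negP => h; apply: Nu.
    by left.
  by right.
have LT : L T = 0.
  rewrite -(cvg_lim _ (cL T))//; apply: cvg_lim => //.
  apply: (@cvg_trans _ ((fun=> 0 : R) @ T^'+)); last exact: cvg_cst.
  apply: near_eq_cvg; near=> y; rewrite patchE memNset//= in_itv/=.
  apply/negP; rewrite negb_and -!ltNge orbC; apply/orP; left.
  by near: y; exact: nbhs_right_gt.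
have Lneg x : x < 0 -> L x = 0.
  move=> x0; rewrite -(cvg_lim _ (cL x))//; apply: cvg_lim => //.
  apply: (@cvg_trans _ ((fun=> 0 : R) @ x^'+)); last exact: cvg_cst.
  apply: near_eq_cvg; near=> y; rewrite patchE memNset//= in_itv/=.
  apply/negP; rewrite negb_and -!ltNge; apply/orP; left.
  by near: y; exact: nbhs_right_lt.
exists nu, N; split; [|split].
- move=> a b ab; rewrite nuab//; congr (_%:E).
  by rewrite (cvg_lim _ (cL a))// (cvg_lim _ (cL b)).
- exists (C + C) => x; rewrite fE (le_trans (ler_normB _ _))// lerD//.
- rewrite fE; apply: measurable_funB; exact: nondecreasing_measurable.
- split; first exact: countable_measurable.
  exact: countable_lebesgue_measure0.
(* [nu] is known on left-open intervals: approach [0, T] by [I k], on which it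
   vanishes because [L] does at both ends. *)
- pose I k : set R := `]- k.+1%:R^-1, T]%classic.
  have I0 : \bigcap_k I k = `[0, T]%classic.
    apply/seteqP; split => [x xI|x].
      rewrite /= in_itv/=; apply/andP; split; last first.
        by have := xI 0%N Logic.I; rewrite /I/= in_itv/= => /andP[].
      rewrite leNgt; apply/negP => x0.
      have h := xI (Num.truncn (- x)^-1) Logic.I.
      move: h; rewrite /I/= in_itv/= => /andP[+ _]; rewrite ltNge => /negP; apply.
      rewrite lerNr invf_ple ?posrE ?oppr_gt0//.
      exact/ltW/truncnS_gt.
    rewrite /= in_itv/= => /andP[x0 xT] k _; rewrite /I/= in_itv/= xT andbT.
    by rewrite (lt_le_trans _ x0)// oppr_lt0.
  have cI (mu : {finite_measure set (measurableTypeR R) -> \bar R}) :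
      mu (I k) @[k --> \oo] --> mu `[0, T]%classic.
    rewrite -I0; apply: nonincreasing_cvg_mu.
    - by rewrite ltey_eq fin_num_measure//; exact: measurable_itv.
    - by move=> k; exact: measurable_itv.
    - by rewrite I0; exact: measurable_itv.
    - move=> i j ij; apply/subsetPset => x; rewrite /I/= !in_itv/=.
      move=> /andP[h ->]; rewrite andbT (le_lt_trans _ h)// lerN2.
      by rewrite lef_pV2 ?posrE// ler_nat.
  have mnI k : m (I k) = n (I k).
    have k0 : - k.+1%:R^-1 < 0 :> R by rewrite oppr_lt0.
    have := nuab (- k.+1%:R^-1) T (ltW (lt_trans k0 T0)).
    rewrite LT Lneg// subrr nuE => /eqP; rewrite sube_eq ?add0e; first by move/eqP.
      by rewrite fin_num_measure//; exact: measurable_itv.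
    by rewrite fin_num_adde_defr.
  rewrite nuE; have -> : m `[0, T]%classic = n `[0, T]%classic.
    apply: cvg_unique (cI m) _ => //.
    by rewrite (_ : (fun k => m (I k)) = (fun k => n (I k))); [exact: cI|exact/funext].
  by rewrite subee// fin_num_measure//; exact: measurable_itv.
- move=> u u0T Nu; have /andP[u0 uT] := u0T; split.
    by rewrite nuab ?(ltW uT)// LT LE//= sub0r.
  move=> v /andP[uv vT] Nv; rewrite nuab//= !LE// (lt_le_trans u0 uv)//.
Unshelve. all: by end_near. Qed.

End bounded_variation_charge.

(** * Pairings of the elementary kernels *)

Lemma measurable_set_bool d (X : measurableType d) (b : X -> bool) :
  measurable_fun [set: X] b -> measurable [set x | b x].
Proof.
move=> mb; rewrite (_ : [set x | b x] = b @^-1` [set true]).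
  by rewrite -[_ @^-1` _]setTI; exact: mb.
by apply/seteqP; split => x.
Qed.

Lemma integrable_ae_eq d (X : measurableType d) (R : realType)
    (mu : {measure set X -> \bar R}) (phi psi : X -> \bar R) :
  mu.-integrable setT phi -> measurable_fun setT psi ->
  {ae mu, forall x, phi x = psi x} ->
  mu.-integrable setT psi /\ (\int[mu]_x phi x = \int[mu]_x psi x)%E.
Proof.
move=> iphi mpsi e; have mphi := measurable_int _ iphi.
have e' : ae_eq mu setT phi psi.
  by apply: filterS e => x + _; exact.
split; last exact: ae_eq_integral.
apply/integrableP; split => //.
have <- : (\int[mu]_x `|phi x| = \int[mu]_x `|psi x|)%E.
  apply: ae_eq_integral => //; [exact: measurableT_comp|exact: measurableT_comp|].
  by apply: filterS e' => x + Dx => /(_ Dx) ->.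
by move/integrableP : iphi => [].
Qed.

Lemma integral_prod_swap d (X : measurableType d) (R : realType)
    (mu : {sigma_finite_measure set X -> \bar R}) (phi : X * X -> \bar R) :
  (mu \x mu)%E.-integrable setT phi ->
  (mu \x mu)%E.-integrable setT (fun x => phi (x.2, x.1)) /\
  (\int[mu \x mu]_x phi (x.2, x.1) = \int[mu \x mu]_x phi x)%E.
Proof.
move=> iphi; have mphi := measurable_int _ iphi.
have mphi' : measurable_fun [set: X * X] (fun x => phi (x.2, x.1)).
  apply: (measurableT_comp mphi) => //=.
  by apply: measurable_fun_pair; [exact: measurable_snd|exact: measurable_fst].
have iphi' : (mu \x mu)%E.-integrable setT (fun x => phi (x.2, x.1)).
  by apply/integrable21ltyP => //=; apply/integrable12ltyP.
split => //.
by rewrite -integral21_prod_meas1// -integral12_prod_meas1.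
Qed.

Lemma prod_measure_null (R : realType) (N : set R) :
  measurable (N : set (measurableTypeR R)) -> lebesgue_measure N = 0%E ->
  let N2 : set (measurableTypeR R * measurableTypeR R) :=
    (N `*` setT) `|` (setT `*` N) in
  measurable N2 /\ prod_measure lebesgue_measure lebesgue_measure N2 = 0%E.
Proof.
move=> mN N0 N2.
pose mu2 := prod_measure (@lebesgue_measure R) (@lebesgue_measure R).
have m1 : measurable (N `*` setT : set (measurableTypeR R * measurableTypeR R)).
  exact: measurableX.
have m2 : measurable (setT `*` N : set (measurableTypeR R * measurableTypeR R)).
  exact: measurableX.
split; first exact: measurableU.
have h1 : mu2 (N `*` setT) = 0%E.
  apply: (etrans (product_measure1E lebesgue_measure lebesgue_measure mN measurableT)).
  by rewrite [X in (X * _)%E]N0 mul0e.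
have h2 : mu2 (setT `*` N) = 0%E.
  apply: (etrans (product_measure1E lebesgue_measure lebesgue_measure measurableT mN)).
  by rewrite [X in (_ * X)%E]N0 mule0.
by apply: (etrans (measureU0 m1 m2 _)).
Qed.

Section pairing_values.
Context {R : realType} (T : R) (T0 : 0 < T)
  (nuf nug : {charge set (measurableTypeR R) -> \bar R})
  (Pf Nf Pg Ng : set R) (hf : hahn_decomposition nuf Pf Nf)
  (hg : hahn_decomposition nug Pg Ng)
  (f g : R -> R) (Ef Eg : set R).

Let F := f \_ `[0, T].
Let G := g \_ `[0, T].
Hypothesis Hf : stieltjes_data T f nuf Ef.
Hypothesis Hg : stieltjes_data T g nug Eg.

Let mF : measurable_fun [set: measurableTypeR R] F. Proof. by case: Hf. Qed.
Let mG : measurable_fun [set: measurableTypeR R] G. Proof. by case: Hg. Qed.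
Let mEf : measurable (Ef : set (measurableTypeR R)).
Proof. by case: Hf => _ _ []. Qed.
Let mEg : measurable (Eg : set (measurableTypeR R)).
Proof. by case: Hg => _ _ []. Qed.
Let Ef0 : lebesgue_measure Ef = 0%E. Proof. by case: Hf => _ _ []. Qed.
Let Eg0 : lebesgue_measure Eg = 0%E. Proof. by case: Hg => _ _ []. Qed.
Let nuf0 : fine (nuf `[0, T]%classic) = 0. Proof. by case: Hf. Qed.
Let nug0 : fine (nug `[0, T]%classic) = 0. Proof. by case: Hg. Qed.
Let nufE u : 0 < u < T -> ~ Ef u ->
  fine (nuf `]u, T]%classic) = - f u /\
  forall v, u <= v < T -> ~ Ef v -> fine (nuf `]u, v]%classic) = f v - f u.
Proof. by case: Hf => _ _ _ _; apply. Qed.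
Let nugE u : 0 < u < T -> ~ Eg u ->
  fine (nug `]u, T]%classic) = - g u /\
  forall v, u <= v < T -> ~ Eg v -> fine (nug `]u, v]%classic) = g v - g u.
Proof. by case: Hg => _ _ _ _; apply. Qed.

Local Notation pairing := (pairing T hf hg).
Local Notation mu := (@lebesgue_measure R).

(** With the two endpoints added, a point of [0, T] that is not exceptional lies
    in the open interval, as [stieltjes_data] demands. *)
Let Ebad : set R := (Ef `|` Eg) `|` [set 0; T].

Let mEbad : measurable (Ebad : set (measurableTypeR R)).
Proof. by apply: measurableU; apply: measurableU. Qed.

Let Ebad0 : lebesgue_measure Ebad = 0%E.
Proof.
have m1 (x : R) : measurable ([set x] : set (measurableTypeR R)) by [].
have h0 : lebesgue_measure ([set 0; T] : set R) = 0%E.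
  apply: (etrans (measureU0 (m1 0) (m1 T) _)); exact: lebesgue_measure_set1.
have h1 : lebesgue_measure (Ef `|` Eg) = 0%E.
  by apply: (etrans (measureU0 mEf mEg _)).
have mfg : measurable (Ef `|` Eg : set (measurableTypeR R)) by exact: measurableU.
have m0T : measurable ([set 0; T] : set (measurableTypeR R)) by exact: measurableU.
by apply: (etrans (measureU0 mfg m0T _)).
Qed.

Let Ebad_oo u : 0 <= u <= T -> ~ Ebad u -> 0 < u < T.
Proof.
move=> /andP[u0 uT] uN; rewrite !lt_neqAle u0 uT !andbT; apply/andP; split.
  by apply/eqP => u0'; apply: uN; right; left.
by apply/eqP => uT'; apply: uN; right; right.
Qed.

Let nufE' u : ~ Ebad u -> 0 < u < T ->
  fine (nuf `]u, T]%classic) = - f u /\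
  forall v, ~ Ebad v -> u <= v < T -> fine (nuf `]u, v]%classic) = f v - f u.
Proof.
move=> uN u0T; have [-> h] := nufE u0T (fun h => uN (or_introl (or_introl h))).
by split => // v vN uvT; apply: h => // h; apply: vN; left; left.
Qed.

Let nugE' u : ~ Ebad u -> 0 < u < T ->
  fine (nug `]u, T]%classic) = - g u /\
  forall v, ~ Ebad v -> u <= v < T -> fine (nug `]u, v]%classic) = g v - g u.
Proof.
move=> uN u0T; have [-> h] := nugE u0T (fun h => uN (or_introl (or_intror h))).
by split => // v vN uvT; apply: h => // h; apply: vN; left; right.
Qed.

Let X : measurableType _ := (measurableTypeR R * measurableTypeR R)%type.

Let mu2 := prod_measure mu mu.

Let Ebad2 : set X := (Ebad `*` setT) `|` (setT `*` Ebad).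

Let mEbad2 : measurable Ebad2.
Proof. by have [] := prod_measure_null mEbad Ebad0. Qed.

Let Ebad20 : mu2 Ebad2 = 0%E.
Proof. by have [] := prod_measure_null mEbad Ebad0. Qed.

(** The interval [`]u, T]] for [0 < u], cut so that it stays inside [0, T] for
    every real [u]. *)
Let ray (u : R) : set R := [set s | (0 < u < s) && (s <= T)].

Let mray : measurable [set z : measurableTypeR R * measurableTypeR R | ray z.1 z.2].
Proof.
apply: measurable_set_bool; apply: measurable_and; first apply: measurable_and.
- by apply: measurable_fun_ltr => //; exact: measurable_fst.
- by apply: measurable_fun_ltr; [exact: measurable_fst|exact: measurable_snd].
- by apply: measurable_fun_ler => //; exact: measurable_snd.
Qed.

Let ray0T u s : ray u s -> 0 <= s <= T.
Proof.
rewrite /ray/= => /andP[/andP[u0 us] ->].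
by rewrite andbT ltW// (lt_trans u0).
Qed.

Let rayE u : 0 < u < T -> ray u = `]u, T]%classic.
Proof.
by move=> /andP[u0 _]; apply/seteqP; split => x; rewrite /ray/= in_itv/= u0.
Qed.

Section weight.
Variables (w Psi : R -> R).
Hypothesis mw : measurable_fun [set: measurableTypeR R] w.
Hypothesis w0 : forall u, 0 < u < T -> 0 <= w u.
Hypothesis mPsi : measurable_fun [set: measurableTypeR R] Psi.
Hypothesis wPsi : forall s, 0 <= s <= T ->
  (\int[mu]_(u in `]0%R, s[) (w u)%:E = (Psi s)%:E)%E.

Let w' u := w u * \1_(`]0%R, T[) u.

Let mw' : measurable_fun [set: measurableTypeR R] w'.
Proof.
by apply: measurable_funM => //; apply: measurable_indic; exact: measurable_itv.
Qed.

Let w'0 u : 0 <= w' u.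
Proof.
rewrite /w' indicE; case: (boolP (u \in _)) => [|_]; last by rewrite mulr0.
by rewrite inE/= in_itv/= => u0T; rewrite mulr1 w0.
Qed.

Let Psi_mono s : 0 <= s <= T -> 0 <= Psi s <= Psi T.
Proof.
move=> /andP[s0 sT]; rewrite -!lee_fin -!wPsi ?lexx ?(ltW T0) ?s0 ?sT//.
have w0e u : 0 < u < T -> (0 <= (w u)%:E)%E by move=> /w0; rewrite lee_fin.
apply/andP; split.
  apply: integral_ge0 => u; rewrite /= in_itv/= => /andP[u0 us].
  by apply: w0e; rewrite u0 (lt_le_trans us).
apply: ge0_subset_integral.
- exact: measurable_itv.
- exact: measurable_itv.
- apply/measurable_EFinP; exact: measurable_funTS.
- by move=> u uT; apply: w0e; move: uT; rewrite /= in_itv.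
- by apply: subset_itvl; rewrite bnd_simp.
Qed.

Let int_w' s t : 0 <= s <= T -> 0 <= t <= T ->
  (\int[mu]_u (w' u * \1_(ray u) s * \1_(`[0%R, T]) t)%:E = (Psi s)%:E)%E.
Proof.
move=> s0T t0T; rewrite -wPsi// [RHS]integral_mkcond; apply: eq_integral => u _.
rewrite patchE /w' !indicE [t \in _]mem_set ?mulr1; last by rewrite /= in_itv.
have /andP[s0 sT] := s0T.
case: ifPn => [|]; rewrite ?inE ?notin_setE/= ?in_itv/=.
  move=> /andP[u0 us]; rewrite !mem_set ?mulr1// /ray/= ?in_itv/= ?u0 ?us ?sT//.
  exact: lt_le_trans sT.
move=> us; rewrite (memNset (A := ray u)) ?mulr0//; apply: contra_not us.
by rewrite /ray/= => /andP[].
Qed.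

Let mB : measurable
  [set z : measurableTypeR R * measurableTypeR R | `[0, T]%classic z.2].
Proof.
rewrite (_ : [set z | _] = setT `*` `[0, T]%classic).
  by apply: measurableX => //; exact: measurable_itv.
by apply/seteqP; split => -[x y]//= [].
Qed.

Let B0T (u : R) s : `[0, T]%classic s -> 0 <= s <= T.
Proof. by rewrite /= in_itv. Qed.

Let normPsi s : 0 <= s <= T -> `|Psi s| <= Psi T.
Proof. by move=> /Psi_mono/andP[Ps0 PsT]; rewrite ger0_norm. Qed.

(** Each rectangle has the side [0, T], of mass 0 for [nug]. *)
Lemma pairing_single_left : pairing (fun s _ => Psi s) 0.
Proof.
have [||v [jv _ vE]] := @pairing_kernel R T nuf nug Pf Nf Pg Ng hf hg _ _
  lebesgue_measure w' ray (fun=> `[0, T]%classic) (fun s _ => Psi s) (Psi T)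
  mw' w'0 mray mB ray0T B0T int_w'.
- exact: measurableT_comp mPsi measurable_fst.
- by move=> s t s0T _; exact: normPsi.
have v0 : v = 0.
  apply: EFin_inj; rewrite -vE; apply: integral0_eq => u _.
  by rewrite nug0 !mulr0.
by rewrite -v0.
Qed.

Lemma pairing_single_right : pairing (fun _ t => Psi t) 0.
Proof.
have [|||v [jv _ vE]] := @pairing_kernel R T nuf nug Pf Nf Pg Ng hf hg _ _
  lebesgue_measure w' (fun=> `[0, T]%classic) ray (fun _ t => Psi t) (Psi T)
  mw' w'0 mB mray B0T ray0T.
- move=> s t s0T t0T; rewrite -(int_w' t0T s0T); apply: eq_integral => u _.
  by rewrite mulrAC.
- exact: measurableT_comp mPsi measurable_snd.
- by move=> s t _ t0T; exact: normPsi.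
have v0 : v = 0.
  apply: EFin_inj; rewrite -vE; apply: integral0_eq => u _.
  by rewrite nuf0 mul0r mulr0.
by rewrite -v0.
Qed.

(** [Num.min s t] exceeds [u] exactly when both [s] and [t] do, so the kernel is a
    superposition of the squares [`]u, T]^2], of mass [(- f u) * (- g u)] for
    almost every [u]. *)
Lemma pairing_min : exists v, [/\ pairing (fun s t => Psi (Num.min s t)) v,
  mu.-integrable `[0, T] (fun u => (f u * g u * w u)%:E) &
  weighted_integral T f g w = v%:E].
Proof.
have min0T s t : 0 <= s <= T -> 0 <= t <= T -> 0 <= Num.min s t <= T.
  by move=> /andP[s0 sT] /andP[t0 tT]; rewrite le_min s0 t0 ge_min sT.
have [|||v [jv iv vE]] := @pairing_kernel R T nuf nug Pf Nf Pg Ng hf hg _ _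
  lebesgue_measure w' ray ray (fun s t => Psi (Num.min s t)) (Psi T)
  mw' w'0 mray mray ray0T ray0T.
- move=> s t s0T t0T; rewrite -(int_w' (min0T _ _ s0T t0T) s0T).
  have /andP[s0 sT] := s0T; have /andP[t0 tT] := t0T.
  apply: eq_integral => u _; congr (_%:E); rewrite -!mulrA; congr (_ * _).
  rewrite !indicE [s \in `[0, T]%classic]mem_set ?mulr1; last by rewrite /= in_itv.
  rewrite -natrM mulnb; congr (_ * (nat_of_bool _)%:R).
  apply/idP/idP.
    move=> /andP[]; rewrite !inE /ray/= => /andP[/andP[u0 us] _] /andP[/andP[_ ut] _].
    by rewrite u0 lt_min us ut ge_min sT.
  rewrite inE /ray/= lt_min => /andP[/and3P[u0 us ut] _].
  by rewrite !mem_set// /ray/= u0 ?us ?ut ?sT ?tT.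
- apply: measurableT_comp => //.
  by apply: measurable_minr; [exact: measurable_fst|exact: measurable_snd].
- by move=> s t s0T t0T; exact/normPsi/min0T.
have [||i' e'] := @integrable_ae_eq _ _ R lebesgue_measure _
    (fun u => (F u * G u * w u)%:E) iv.
- apply/measurable_EFinP; apply: measurable_funM => //; exact: measurable_funM.
- exists Ebad; split => // u /= uE; apply: contrapT => uN; apply: uE.
  congr (_%:E).
  rewrite /F /G !patchE /w' indicE.
  have [u0T|u0T] := boolP (0 < u < T).
    have uI : u \in (`[0, T]%classic : set R).
      by rewrite inE/= in_itv/=; move: u0T => /andP[? ?]; rewrite !ltW.
    have uO : u \in (`]0, T[%classic : set R) by rewrite inE/= in_itv.
    rewrite uI uO rayE//.
    have [-> _] := nufE' uN u0T.
    have [-> _] := nugE' uN u0T.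
    by rewrite mulr1 mulrNN mulrC.
  rewrite [u \in `]0, T[%classic]memNset; last by rewrite /= in_itv/=; exact/negP.
  rewrite memNset; first by rewrite !mulr0 !mul0r.
  rewrite /= in_itv/= => u0T'; move: u0T; by rewrite Ebad_oo.
exists v; split => //.
  have mI : measurable (`[0, T]%classic : set (measurableTypeR R)) by [].
  apply/(integrable_mkcond _ mI).
  apply: eq_integrable i' => // u _.
  by rewrite /F /G !patchE; case: ifPn => //; rewrite !mul0r.
rewrite /weighted_integral -vE e' [LHS]integral_mkcond; apply: eq_integral => u _.
by rewrite /F /G !patchE; case: ifPn => //; rewrite !mul0r.
Qed.

End weight.

Section rectangle.
Variables (k Psi : R -> R -> R) (M : R).
Hypothesis mk : measurable_fun [set: X] (fun z => k z.1 z.2).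
Hypothesis k0 : forall u v, 0 < u < T -> 0 < v < T -> 0 <= k u v.
Hypothesis mPsi : measurable_fun [set: X] (fun z => Psi z.1 z.2).
Hypothesis PsiM : forall s t, 0 <= s <= T -> 0 <= t <= T -> `|Psi s t| <= M.
Hypothesis kPsi : forall s t, 0 <= s <= T -> 0 <= t <= T ->
  (\int[mu]_(u in `]0%R, s[) \int[mu]_(v in `]0%R, t[) (k u v)%:E =
   (Psi s t)%:E)%E.

Let w (x : X) := k x.1 x.2 * \1_(`]0%R, T[) x.1 * \1_(`]0%R, T[) x.2.

Let mw : measurable_fun [set: X] w.
Proof.
have m1 : measurable_fun [set: measurableTypeR R] (\1_(`]0%R, T[) : R -> R).
  by apply: measurable_indic; exact: measurable_itv.
apply: measurable_funM; first apply: measurable_funM => //.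
  exact: measurableT_comp m1 measurable_fst.
exact: measurableT_comp m1 measurable_snd.
Qed.

Let w0 x : 0 <= w x.
Proof.
rewrite /w !indicE; case: (boolP (x.1 \in _)) => [|_]; last by rewrite mulr0 mul0r.
case: (boolP (x.2 \in _)) => [|_]; last by rewrite mulr0.
by rewrite !inE/= !in_itv/= => ? ?; rewrite !mulr1 k0.
Qed.

Let mray1 : measurable [set z : X * measurableTypeR R | ray z.1.1 z.2].
Proof.
rewrite (_ : [set z | _] = (fun z => (z.1.1, z.2)) @^-1`
  [set z : measurableTypeR R * measurableTypeR R | ray z.1 z.2])//.
rewrite -[_ @^-1` _]setTI.
have h : measurable_fun [set: X * measurableTypeR R]
    (fun z => (z.1.1, z.2) : measurableTypeR R * measurableTypeR R).
  apply: measurable_fun_pair; last exact: measurable_snd.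
  exact: measurableT_comp measurable_fst measurable_fst.
exact: h.
Qed.

Let mray2 : measurable [set z : X * measurableTypeR R | ray z.1.2 z.2].
Proof.
rewrite (_ : [set z | _] = (fun z => (z.1.2, z.2)) @^-1`
  [set z : measurableTypeR R * measurableTypeR R | ray z.1 z.2])//.
rewrite -[_ @^-1` _]setTI.
have h : measurable_fun [set: X * measurableTypeR R]
    (fun z => (z.1.2, z.2) : measurableTypeR R * measurableTypeR R).
  apply: measurable_fun_pair; last exact: measurable_snd.
  exact: measurableT_comp measurable_snd measurable_fst.
exact: h.
Qed.

Let indic_rayE u s : 0 <= s <= T ->
  (\1_(`]0%R, T[) u * \1_(ray u) s : R) = \1_(`]0%R, s[) u.
Proof.
move=> /andP[s0 sT]; rewrite !indicE -natrM mulnb; congr ((nat_of_bool _)%:R).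
apply/idP/idP.
  move=> /andP[]; rewrite !inE/= !in_itv/= => /andP[u0 uT] /andP[/andP[_ us] _].
  by rewrite u0.
rewrite inE/= in_itv/= => /andP[u0 us]; apply/andP; rewrite !inE/= in_itv/= /ray/=.
by rewrite u0 us sT (lt_le_trans us sT).
Qed.

Let int_w s t : 0 <= s <= T -> 0 <= t <= T ->
  (\int[mu2]_x (w x * \1_(ray x.1) s * \1_(ray x.2) t)%:E = (Psi s t)%:E)%E.
Proof.
move=> s0T t0T.
pose h (x : X) : \bar R := (k x.1 x.2 * \1_(`]0%R, s[) x.1 * \1_(`]0%R, t[) x.2)%:E.
have hE x : (w x * \1_(ray x.1) s * \1_(ray x.2) t)%:E = h x.
  by rewrite /h -(indic_rayE _ s0T) -(indic_rayE _ t0T) /w; congr (_%:E); ring.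
have mh : measurable_fun setT h.
  apply/measurable_EFinP.
  have m1 r : measurable_fun [set: measurableTypeR R] (\1_(`]0%R, r[) : R -> R).
    by apply: measurable_indic; exact: measurable_itv.
  apply: measurable_funM; first apply: measurable_funM => //.
    exact: measurableT_comp (m1 s) measurable_fst.
  exact: measurableT_comp (m1 t) measurable_snd.
have h0 x : (0 <= h x)%E.
  by rewrite -hE lee_fin mulr_ge0 ?indicE ?ler0n// mulr_ge0 ?w0// ler0n.
rewrite -kPsi//; under eq_integral do rewrite hE.
apply: (etrans (fubini_tonelli1 (m1 := mu) (m2 := mu) h mh h0)).
rewrite /fubini_F [RHS]integral_mkcond; apply: eq_integral => u _.
rewrite patchE; case: ifPn => us.
  rewrite [RHS]integral_mkcond; apply: eq_integral => v _.
  rewrite patchE /h/= !indicE us mulr1; case: ifPn => vt; first by rewrite mulr1.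
  by rewrite mulr0.
by apply: integral0_eq => v _; rewrite /h/= indicE (negbTE us) mulr0 mul0r.
Qed.

(** The kernel is a superposition of the quadrants [`]u, T] x ]v, T]], of mass
    [(- f u) * (- g v)] for almost all [u] and [v]. *)
Lemma pairing_rectangle : exists v, [/\ pairing Psi v,
  mu2.-integrable (`[0, T] `*` `[0, T]) (fun x => (f x.1 * g x.2 * k x.1 x.2)%:E) &
  double_integral T f g (fun s t => k t s) = v%:E].
Proof.
have [v [jv iv vE]] := @pairing_kernel R T nuf nug Pf Nf Pg Ng hf hg _ X
  mu2 w (fun x => ray x.1) (fun x => ray x.2) Psi M
  mw w0 mray1 mray2 (fun x => @ray0T x.1) (fun x => @ray0T x.2) int_w mPsi PsiM.
have [||i' e'] := @integrable_ae_eq _ _ R mu2 _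
    (fun x => (F x.1 * G x.2 * k x.1 x.2)%:E) iv.
- apply/measurable_EFinP; apply: measurable_funM => //; apply: measurable_funM.
    exact: measurableT_comp mF measurable_fst.
  exact: measurableT_comp mG measurable_snd.
- exists Ebad2; split => // -[a b] /= abE; apply: contrapT => abN; apply: abE.
  have aN : ~ Ebad a by move=> h; apply: abN; left.
  have bN : ~ Ebad b by move=> h; apply: abN; right.
  congr (_%:E); rewrite /F /G !patchE /w/= !indicE.
  have key c : ~ Ebad c ->
      (c \in (`[0, T]%classic : set R)) = (c \in (`]0, T[%classic : set R)).
    move=> cN; apply/idP/idP; rewrite !inE/= !in_itv/=; first by move=> /Ebad_oo; apply.
    by move=> /andP[? ?]; rewrite !ltW.
  rewrite !key//.
  case: (boolP (a \in _)) => [|_]; last by rewrite mulr0 !mul0r.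
  case: (boolP (b \in _)) => [|_]; last by rewrite mulr0 !mul0r mulr0 mul0r.
  rewrite !inE/= !in_itv/= => b0T a0T; rewrite !rayE//.
  have [-> _] := nufE' aN a0T; have [-> _] := nugE' bN b0T.
  by rewrite !mulr1 mulrNN mulrC.
have FGE (x : X) : (F x.1 * G x.2 * k x.1 x.2)%:E =
    ((fun x : X => (f x.1 * g x.2 * k x.1 x.2)%:E) \_ (`[0, T] `*` `[0, T])) x.
  rewrite patchE /F /G !patchE in_setX.
  by case: (x.1 \in _); case: (x.2 \in _); rewrite /= ?mulr0 ?mul0r.
exists v; split => //.
  have mI : measurable (`[0, T]%classic `*` `[0, T]%classic : set X).
    by apply: measurableX; exact: measurable_itv.
  apply/(integrable_mkcond _ mI).
  by apply: eq_integrable i' => // u _; exact: FGE.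
rewrite /double_integral -vE e' [LHS]integral_mkcond.
by apply: eq_integral => x _; rewrite FGE.
Qed.

End rectangle.

Section diagonal.
Variables (r : R) (r01 : 0 < r < 1).
Variable Z : set R.
Hypothesis mZ : measurable (Z : set (measurableTypeR R)).
Hypothesis Z0 : lebesgue_measure Z = 0%E.
Hypothesis fgZ : forall u, 0 <= u <= T -> ~ Z u -> f u * g u = 0.

Let c := r * (1 - r).

Let c0 : 0 < c. Proof. by rewrite /c; move: r01 => /andP[? ?]; rewrite mulr_gt0// subr_gt0. Qed.

Let tri (x : X) := [&& 0 < x.1, x.1 < x.2 & x.2 < T].

Let w (x : X) := c * (x.2 - x.1) `^ (r - 2) * \1_[set x | tri x] x.

Let mtri : measurable [set x | tri x].
Proof.
apply: measurable_set_bool; apply: measurable_and; last apply: measurable_and.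
- by apply: measurable_fun_ltr => //; exact: measurable_fst.
- by apply: measurable_fun_ltr; [exact: measurable_fst|exact: measurable_snd].
- by apply: measurable_fun_ltr => //; exact: measurable_snd.
Qed.

Let mw : measurable_fun [set: X] w.
Proof.
apply: measurable_funM; last exact: measurable_indic.
apply: measurable_funM => //; apply: (measurableT_comp (measurable_powR _)) => //=.
by apply: measurable_funB; [exact: measurable_snd|exact: measurable_fst].
Qed.

Let w0 x : 0 <= w x.
Proof. by rewrite /w mulr_ge0 ?indicE ?ler0n// mulr_ge0 ?powR_ge0// ltW. Qed.

Let A (x : X) : set R := [set s | [&& 0 < x.1, x.1 < s, s <= x.2 & x.2 <= T]].

Let mA : measurable [set z : X * measurableTypeR R | A z.1 z.2].
Proof.
have m1 : measurable_fun [set: X * measurableTypeR R] (fun z => z.1.1).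
  exact: measurableT_comp measurable_fst measurable_fst.
have m2 : measurable_fun [set: X * measurableTypeR R] (fun z => z.1.2).
  exact: measurableT_comp measurable_snd measurable_fst.
apply: measurable_set_bool; apply: measurable_and.
  exact: measurable_fun_ltr.
apply: measurable_and; first by apply: measurable_fun_ltr => //; exact: measurable_snd.
apply: measurable_and; first by apply: measurable_fun_ler => //; exact: measurable_snd.
exact: measurable_fun_ler.
Qed.

Let A0T x s : A x s -> 0 <= s <= T.
Proof.
rewrite /A/= => /and4P[u0 us sv vT].
by rewrite ltW ?(lt_trans u0)// (le_trans sv).
Qed.

(** The superposition of the squares [`]u, v]^2], [0 < u < v < T], with weight
    [c * (v - u) `^ (r - 2)]. *)
Let Psi s t := Num.max s t `^ r - `|t - s| `^ r -
  (T `^ r - (T - Num.min s t) `^ r).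

Let mPsi : measurable_fun [set: X] (fun z => Psi z.1 z.2).
Proof.
have mp : measurable_fun [set: measurableTypeR R] (fun u : R => u `^ r).
  exact: measurable_powR.
apply: measurable_funB; first apply: measurable_funB.
- apply: (measurableT_comp mp) => /=.
  by apply: measurable_maxr; [exact: measurable_fst|exact: measurable_snd].
- apply: (measurableT_comp mp) => /=; apply: measurableT_comp => //.
  by apply: measurable_funB; [exact: measurable_snd|exact: measurable_fst].
- apply: measurable_funB => //; apply: (measurableT_comp mp) => /=.
  apply: measurable_funB => //.
  by apply: measurable_minr; [exact: measurable_fst|exact: measurable_snd].
Qed.

Let PsiM s t : 0 <= s <= T -> 0 <= t <= T -> `|Psi s t| <= 4 * T `^ r.
Proof.
move=> /andP[s0 sT] /andP[t0 tT]; have /andP[r0 r1] := r01.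
have le x : 0 <= x -> x <= T -> 0 <= x `^ r <= T `^ r.
  move=> x0 xT; rewrite powR_ge0/= ge0_ler_powR ?(ltW r0)// nnegrE//.
  exact: le_trans xT.
have /andP[h1 h1'] : 0 <= Num.max s t `^ r <= T `^ r.
  by apply: le; rewrite ?le_max ?s0// ge_max sT.
have /andP[h2 h2'] : 0 <= `|t - s| `^ r <= T `^ r.
  by apply: le => //; rewrite ler_norml; apply/andP; split; lra.
have /andP[h3 h3'] : 0 <= (T - Num.min s t) `^ r <= T `^ r.
  apply: le; first by rewrite subr_ge0 ge_min sT.
  by rewrite gerBl le_min s0.
have h4 := powR_ge0 T r.
by rewrite /Psi ler_norml; apply/andP; split; lra.
Qed.

Let int_w s t : 0 <= s <= T -> 0 <= t <= T ->
  (\int[mu2]_x (w x * \1_(A x) s * \1_(A x) t)%:E = (Psi s t)%:E)%E.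
Proof.
wlog st : s t / s <= t.
  move=> h s0T t0T; case: (leP s t) => st; first exact: h.
  transitivity (Psi t s)%:E; last by rewrite /Psi maxC distrC minC.
  rewrite -(h t s)//; last exact: ltW.
  by apply: eq_integral => x _; rewrite mulrAC.
move=> /andP[s0 sT] /andP[t0 tT].
pose h (x : X) : \bar R := (c * (x.2 - x.1) `^ (r - 2) *
  \1_(`]0%R, s[) x.1 * \1_(`[t, T[) x.2)%:E.
have hE x : (w x * \1_(A x) s * \1_(A x) t)%:E = h x.
  rewrite /h /w -!mulrA; congr (_%:E); congr (_ * (_ * _)).
  rewrite !indicE -!natrM !mulnb; congr (_ * (nat_of_bool _)%:R).
  apply/idP/idP.
    move=> /and3P[/set_mem/and3P[u0 uv vT] /set_mem/and4P[_ us sv _]].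
    move=> /set_mem/and4P[_ ut tv _].
    by apply/andP; split; apply/mem_set; rewrite /= in_itv/= ?u0 ?us ?tv ?vT.
  move=> /andP[/set_mem + /set_mem]; rewrite /= !in_itv/=.
  move=> /andP[u0 us] /andP[tv vT].
  have ut := lt_le_trans us st; have uv := lt_le_trans ut tv.
  have sv := le_trans st tv.
  by apply/and3P; split; apply/mem_set; rewrite /= /tri /A/= u0 ?us ?ut ?uv ?sv ?tv ?vT ?(ltW vT).
have mh : measurable_fun setT h.
  apply/measurable_EFinP.
  apply: measurable_funM; first apply: measurable_funM.
  - apply: measurable_funM => //; apply: (measurableT_comp (measurable_powR _)) => //=.
    by apply: measurable_funB; [exact: measurable_snd|exact: measurable_fst].
  - have m1 : measurable_fun [set: measurableTypeR R] (\1_(`]0%R, s[) : R -> R).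
      by apply: measurable_indic; exact: measurable_itv.
    exact: measurableT_comp m1 measurable_fst.
  - have m1 : measurable_fun [set: measurableTypeR R] (\1_(`[t, T[) : R -> R).
      by apply: measurable_indic; exact: measurable_itv.
    exact: measurableT_comp m1 measurable_snd.
have h0 x : (0 <= h x)%E.
  by rewrite -hE lee_fin mulr_ge0 ?indicE ?ler0n// mulr_ge0 ?w0// ler0n.
under eq_integral do rewrite hE.
apply: (etrans (fubini_tonelli1 (m1 := mu) (m2 := mu) h mh h0)).
have <- : (\int[mu]_(u in `]0%R, s[) \int[mu]_(v in `]t, T[)
    (c * (v - u) `^ (r - 2))%:E = (Psi s t)%:E)%E.
  rewrite integral2_powRB_diag ?s0 ?tT// /Psi max_r// min_l// ger0_norm//.
  by rewrite subr_ge0.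
rewrite /fubini_F [RHS]integral_mkcond; apply: eq_integral => u _.
rewrite patchE; case: ifPn => us; last first.
  by apply: integral0_eq => v _; rewrite /h/= indicE (negbTE us) mulr0 mul0r.
rewrite integral_itv_obnd_cbnd; last first.
  apply/measurable_EFinP; apply: measurable_funM => //.
  apply: (measurableT_comp (measurable_powR _)) => //=.
  exact: measurable_funB.
rewrite [RHS]integral_mkcond; apply: eq_integral => v _.
rewrite patchE /h/= !indicE us mulr1; case: ifPn => vt; first by rewrite mulr1.
by rewrite mulr0.
Qed.

Let bad := Ebad `|` Z.

(** Cutting [f] and [g] to 0 on the null set where something may fail makes their
    product vanish everywhere, so that the two cross terms below can be compared
    point by point. *)
Let F' u := F u * \1_(~` bad) u.
Let G' u := G u * \1_(~` bad) u.

Let F'G' u : F' u * G' u = 0.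
Proof.
rewrite /F' /G' mulrACA indicE; case: (boolP (u \in ~` bad)); last by rewrite !mulr0.
rewrite inE => uN; rewrite !mulr1 /F /G !patchE; case: ifPn => [|_]; last first.
  by rewrite mul0r.
rewrite inE/= in_itv/= => u0T; apply: fgZ => // uZ; apply: uN; by right.
Qed.

Let mbad : measurable (~` bad : set (measurableTypeR R)).
Proof. by apply: measurableC; exact: measurableU. Qed.

Let mF' : measurable_fun [set: measurableTypeR R] F'.
Proof. by apply: measurable_funM => //; exact: measurable_indic. Qed.

Let mG' : measurable_fun [set: measurableTypeR R] G'.
Proof. by apply: measurable_funM => //; exact: measurable_indic. Qed.

Let mbad' : measurable (bad : set (measurableTypeR R)).
Proof. exact: measurableU. Qed.

Let bad0 : lebesgue_measure bad = 0%E.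
Proof. by apply: (etrans (measureU0 mEbad mZ _)). Qed.

Let F'E u : 0 < u < T -> ~ bad u -> F' u = f u.
Proof.
move=> /andP[u0 uT] uN; rewrite /F' /F indicE mem_set// mulr1 patchE mem_set//.
by rewrite /= in_itv/= !ltW.
Qed.

Let G'E u : 0 < u < T -> ~ bad u -> G' u = g u.
Proof.
move=> /andP[u0 uT] uN; rewrite /G' /G indicE mem_set// mulr1 patchE mem_set//.
by rewrite /= in_itv/= !ltW.
Qed.

Let F'0T u : F' u != 0 -> 0 < u < T.
Proof.
apply: contraNT => u0T; rewrite /F' /F patchE indicE; case: ifPn; last by rewrite mul0r.
rewrite inE/= in_itv/= => uT; rewrite memNset ?mulr0// => uN.
by move: u0T; rewrite Ebad_oo// => h; apply: uN; left.
Qed.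

Let G'0T u : G' u != 0 -> 0 < u < T.
Proof.
apply: contraNT => u0T; rewrite /G' /G patchE indicE; case: ifPn; last by rewrite mul0r.
rewrite inE/= in_itv/= => uT; rewrite memNset ?mulr0// => uN.
by move: u0T; rewrite Ebad_oo// => h; apply: uN; left.
Qed.

(** The square [`]u, v]^2] has mass [(f v - f u) * (g v - g u)], which is
    [- (f u * g v + f v * g u)] because [f * g = 0].  Of the two cross terms at most
    one is nonzero at a given point, so that each of them is integrable.
    Transposing the second, which lives on [u < v], completes the first to the
    integral of [f t * g s * `|t - s| `^ (r - 2)] over the whole square. *)
Lemma pairing_diagonal : exists v d, [/\ pairing Psi v,
  double_integral T f g (fun s t => `|t - s| `^ (r - 2)) = d%:E &
  v = - c * d].
Proof.
have [v [jv iv vE]] := @pairing_kernel R T nuf nug Pf Nf Pg Ng hf hg _ X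
  mu2 w A A Psi (4 * T `^ r) mw w0 mA mA A0T A0T int_w mPsi PsiM.
exists v.
pose psi1 (x : X) := F' x.1 * G' x.2 * w x.
pose psi2 (x : X) := F' x.2 * G' x.1 * w x.
have m1 : measurable_fun [set: X] psi1.
  apply: measurable_funM => //; apply: measurable_funM.
    exact: measurableT_comp mF' measurable_fst.
  exact: measurableT_comp mG' measurable_snd.
have m2 : measurable_fun [set: X] psi2.
  apply: measurable_funM => //; apply: measurable_funM.
    exact: measurableT_comp mF' measurable_snd.
  exact: measurableT_comp mG' measurable_fst.
have [||i' e'] := @integrable_ae_eq _ _ R mu2 _
    (fun x => (- (psi1 x + psi2 x))%:E) iv.
- by apply/measurable_EFinP; apply: measurableT_comp => //; exact: measurable_funD.
- have [mN2 N20] := prod_measure_null mbad' bad0.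
  exists ((bad `*` setT) `|` (setT `*` bad)); split; [exact: mN2|exact: N20|].
  move=> -[a b] /= abE; apply: contrapT => abN; apply: abE.
  have aN : ~ bad a by move=> h; apply: abN; left.
  have bN : ~ bad b by move=> h; apply: abN; right.
  have [aE bE] : ~ Ebad a /\ ~ Ebad b.
    by split => h; [apply: aN|apply: bN]; left.
  congr (_%:E); rewrite /psi1 /psi2 /w/= indicE.
  case: (boolP ((a, b) \in _)) => [|_]; last by rewrite !mulr0 mul0r addr0 oppr0.
  rewrite inE /tri/= => /and3P[a0 ab bT]; rewrite mulr1.
  have aT := lt_trans ab bT; have b0 := lt_trans a0 ab.
  have AE : A (a, b) = `]a, b]%classic.
    apply/seteqP; split => s; rewrite /A/= in_itv/= a0 (ltW bT) ?andbT//.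
  have a0T : 0 < a < T by rewrite a0.
  have b0T : 0 < b < T by rewrite b0.
  have abT : a <= b < T by rewrite ltW.
  have [_ /(_ b bE abT)] := nufE' aE a0T; have [_ /(_ b bE abT)] := nugE' aE a0T.
  rewrite AE => -> ->; rewrite !F'E// !G'E//.
  have fga : f a * g a = 0.
    by apply: fgZ; [rewrite (ltW a0) (ltW aT)|move=> h; apply: aN; right].
  have fgb : f b * g b = 0.
    by apply: fgZ; [rewrite (ltW b0) (ltW bT)|move=> h; apply: bN; right].
  rewrite (_ : (f b - f a) * (g b - g a) = - (f a * g b + f b * g a)); first by ring.
  by transitivity (f b * g b + f a * g a - (f a * g b + f b * g a));
    [ring|rewrite fga fgb !add0r].
(* One of the two cross terms is 0, so their sum dominates each of them. *)
have le1 a b a' b' : a * a' = 0 -> b * b' = 0 -> `|a * b'| <= `|a * b' + b * a'|.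
  move=> aa bb; have [->|] := eqVneq (a * b') 0; first by rewrite normr0.
  rewrite mulf_eq0 negb_or => /andP[_ b'0].
  by move/eqP: bb; rewrite mulf_eq0 (negbTE b'0) orbF => /eqP ->; rewrite mul0r addr0.
have i1 : mu2.-integrable setT (fun x => (psi1 x)%:E).
  apply: le_integrable i' => //; first exact/measurable_EFinP.
  move=> x _; rewrite lee_fin normrN /psi1 /psi2 -mulrDl !normrM ler_wpM2r//.
  by rewrite -!normrM; apply: le1; exact: F'G'.
have i2 : mu2.-integrable setT (fun x => (psi2 x)%:E).
  apply: le_integrable i' => //; first exact/measurable_EFinP.
  move=> x _; rewrite lee_fin normrN /psi1 /psi2 -mulrDl !normrM ler_wpM2r//.
  by rewrite -!normrM addrC; apply: le1; exact: F'G'.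
have vE' : (- (\int[mu2]_x (psi1 x)%:E + \int[mu2]_x (psi2 x)%:E) = v%:E)%E.
  rewrite -vE e'; under [RHS]eq_integral do rewrite EFinN EFinD.
  by rewrite integralN ?integralD//; apply: integrable_add_def;
    [exact: measurableT|exact: (integrableD measurableT i1 i2)].
(* The transpose of [psi2] lives below the diagonal, next to [psi1] above it. *)
have [i3 e3] := integral_prod_swap i2.
pose h (x : X) := F' x.1 * G' x.2 * (c * `|x.1 - x.2| `^ (r - 2)).
have hE x : (h x)%:E = ((psi1 x)%:E + (psi2 (x.2, x.1))%:E)%E.
  rewrite -EFinD; congr (_%:E); rewrite /psi1 /psi2 /h /w/= -!mulrDr.
  have [->|F0] := eqVneq (F' x.1) 0; first by rewrite !mul0r.
  have [->|G0] := eqVneq (G' x.2) 0; first by rewrite !mulr0 !mul0r.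
  have x1 := F'0T F0; have x2 := G'0T G0.
  rewrite !indicE; case: (ltgtP x.1 x.2) => x12.
  - rewrite mem_set; last by rewrite /= /tri; case/andP: x1 => ->; case/andP: x2 => _ ->; rewrite x12.
    rewrite memNset ?mulr0 ?addr0 ?mulr1; last first.
      by rewrite /= /tri/= (lt_gtF x12) andbF.
    by rewrite distrC gtr0_norm// subr_gt0.
  - rewrite memNset; last by rewrite /= /tri/= (lt_gtF x12) andbF.
    rewrite mem_set ?mulr0 ?add0r ?mulr1; last first.
      by rewrite /= /tri/=; case/andP: x2 => ->; case/andP: x1 => _ ->; rewrite x12.
    by rewrite gtr0_norm// subr_gt0.
  - by have := F'G' x.1; rewrite {2}x12 => ->; rewrite !mul0r.
have ih : mu2.-integrable setT (fun x => (h x)%:E).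
  by apply: eq_integrable (integrableD measurableT i1 i3) => // x _; rewrite hE.
have hv : (\int[mu2]_x (h x)%:E = (- v)%:E)%E.
  under eq_integral do rewrite hE.
  by rewrite integralD// e3 EFinN -vE' oppeK.
pose k (x : X) := F x.1 * G x.2 * `|x.1 - x.2| `^ (r - 2).
have mk : measurable_fun [set: X] k.
  apply: measurable_funM.
    apply: measurable_funM.
      exact: measurableT_comp mF measurable_fst.
    exact: measurableT_comp mG measurable_snd.
  apply: (measurableT_comp (measurable_powR _)) => //=; apply: measurableT_comp => //.
  by apply: measurable_funB; [exact: measurable_fst|exact: measurable_snd].
have [||ik ek] := @integrable_ae_eq _ _ R mu2 _ (fun x => (k x)%:E)
    (integrableZl measurableT c^-1 ih).
- exact/measurable_EFinP.
- have [mN2 N20] := prod_measure_null mbad' bad0.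
  exists ((bad `*` setT) `|` (setT `*` bad)); split; [exact: mN2|exact: N20|].
  move=> -[a b] /= abE; apply: contrapT => abN; apply: abE.
  have aN : ~ bad a by move=> h'; apply: abN; left.
  have bN : ~ bad b by move=> h'; apply: abN; right.
  rewrite -EFinM; congr (_%:E); rewrite /h /k/= /F' /G' !indicE !mem_set//.
  by rewrite /= !mulr1 mulrCA mulKf// gt_eqF.
exists (c^-1 * - v); split => //; last by rewrite mulrN mulNr mulrN opprK mulVKf// gt_eqF.
have -> : (c^-1 * - v)%:E = (\int[mu2]_x (k x)%:E)%E.
  by rewrite -ek integralZl// hv EFinM.
rewrite /double_integral [LHS]integral_mkcond; apply: eq_integral => x _.
rewrite patchE /k /F /G !patchE in_setX.
by case: (x.1 \in _); case: (x.2 \in _); rewrite /= ?mulr0 ?mul0r.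
Qed.

End diagonal.

End pairing_values.

(** * Covariances with an integrable mixed derivative *)

(** The mixed derivative of [(s `^ p + t `^ p) `^ q] at positive [s] and [t]. *)
Definition power_kernel (R : realType) (p q s t : R) : R :=
  q * (q - 1) * p ^+ 2 * ((t * s) `^ (p - 1) * (t `^ p + s `^ p) `^ (q - 2)).

(** Removing the two one-variable powers, which have no mixed derivative, makes
    the function vanish on the axes: it is then the integral of [power_kernel p q]
    over [`]0, s[ x ]0, t[]. *)
Definition sum_power (R : realType) (p q s t : R) : R :=
  (s `^ p + t `^ p) `^ q - s `^ (p * q) - t `^ (p * q).

Section represented.
Context {R : realType} (T : R) (T0 : 0 < T)
  (nuf nug : {charge set (measurableTypeR R) -> \bar R})
  (Pf Nf Pg Ng : set R) (hf : hahn_decomposition nuf Pf Nf)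
  (hg : hahn_decomposition nug Pg Ng)
  (f g : R -> R) (Ef Eg : set R).
Hypothesis Hf : stieltjes_data T f nuf Ef.
Hypothesis Hg : stieltjes_data T g nug Eg.

Local Notation pairing := (pairing T hf hg).
Local Notation mu := (@lebesgue_measure R).
Let X : measurableType _ := (measurableTypeR R * measurableTypeR R)%type.
Let mu2 := prod_measure mu mu.
Let I2 : set X := `[0, T] `*` `[0, T].

Let mI2 : measurable I2.
Proof. by apply: measurableX; exact: measurable_itv. Qed.

Let mI : measurable (`[0, T]%classic : set (measurableTypeR R)).
Proof. exact: measurable_itv. Qed.

(** Seen from [f] and [g], [k] is the mixed derivative of [K].  The last clause
    serves to write the double integral as an iterated one, in which [f t] stands
    outside the inner integral; it leaves out [t = 0], where [power_kernel] may
    fail to be integrable in [s]. *)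
Definition represented (K k : R -> R -> R) : Prop :=
  [/\ pairing K (fine (double_integral T f g k)),
      mu2.-integrable I2 (fun x => (f x.1 * g x.2 * k x.2 x.1)%:E) &
      forall t, 0 < t <= T -> mu.-integrable `[0, T] (fun s => (k s t)%:E)].

Lemma represented_ext K1 K2 k1 k2 :
  (forall s t, 0 <= s <= T -> 0 <= t <= T -> K1 s t = K2 s t) ->
  (forall s t, 0 <= s <= T -> 0 <= t <= T -> k1 s t = k2 s t) ->
  represented K1 k1 -> represented K2 k2.
Proof.
move=> KE kE [jK ik ikt].
have e (x : X) : I2 x -> f x.1 * g x.2 * k1 x.2 x.1 = f x.1 * g x.2 * k2 x.2 x.1.
  by case: x => s t; rewrite /I2/= !in_itv/= => -[s0 t0]; rewrite kE.
split.
- rewrite (_ : double_integral T f g k2 = double_integral T f g k1).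
    exact: pairing_ext jK.
  by apply: eq_integral => x; rewrite inE => /e ->.
- by apply: eq_integrable ik => // x; rewrite inE => /e ->.
- move=> t t0T; apply: eq_integrable (ikt _ t0T) => // s.
  rewrite inE/= in_itv/= => s0T; rewrite kE//.
  by case/andP: t0T => /ltW -> ->.
Qed.

Lemma representedZD a K1 K2 k1 k2 : represented K1 k1 -> represented K2 k2 ->
  represented (fun s t => a * K1 s t + K2 s t) (fun s t => a * k1 s t + k2 s t).
Proof.
move=> [j1 i1 it1] [j2 i2 it2].
have E (x : X) : (f x.1 * g x.2 * (a * k1 x.2 x.1 + k2 x.2 x.1))%:E =
    (a%:E * (f x.1 * g x.2 * k1 x.2 x.1)%:E + (f x.1 * g x.2 * k2 x.2 x.1)%:E)%E.
  by rewrite -EFinM -EFinD; congr (_%:E); ring.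
have ai := integrableZl mI2 a i1.
have i12 : mu2.-integrable I2
    (fun x => (f x.1 * g x.2 * (a * k1 x.2 x.1 + k2 x.2 x.1))%:E).
  by apply: eq_integrable (integrableD mI2 ai i2) => // x _; exact/esym/E.
have d12 : (double_integral T f g (fun s t => a * k1 s t + k2 s t)%R =
    a%:E * double_integral T f g k1 + double_integral T f g k2)%E.
  transitivity (\int[mu2]_(x in I2) (a%:E * (f x.1 * g x.2 * k1 x.2 x.1)%:E +
      (f x.1 * g x.2 * k2 x.2 x.1)%:E))%E.
    by apply: eq_integral => x _; exact: E.
  by rewrite integralD// integralZl.
have f1 : double_integral T f g k1 \is a fin_num := integrable_fin_num mI2 i1.
have f2 : double_integral T f g k2 \is a fin_num := integrable_fin_num mI2 i2.
split; [|exact: i12|].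
- rewrite d12 -[in fine _](fineK f1) -[in fine _](fineK f2) -EFinM -EFinD/=.
  exact: pairingZD.
- move=> t t0T; have ait := integrableZl mI a (it1 t t0T).
  by apply: eq_integrable (integrableD mI ait (it2 t t0T)).
Qed.

Lemma represented0 K : pairing K 0 -> represented K (fun _ _ => 0).
Proof.
move=> jK.
have z (x : X) : (f x.1 * g x.2 * 0)%:E = 0%E by rewrite mulr0.
split.
- rewrite (_ : double_integral T f g _ = 0%E)// /double_integral.
  by apply: integral0_eq => x _; exact: z.
- by apply: eq_integrable (integrable0 _ _ ) => // x _; rewrite z.
- by move=> t _; exact: integrable0.
Qed.

Let mpow p : measurable_fun [set: measurableTypeR R] (fun u : R => u `^ p).
Proof. exact: measurable_powR. Qed.

Lemma represented_powR_left p : 0 < p ->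
  represented (fun s _ => s `^ p) (fun _ _ => 0).
Proof.
move=> p0; apply: represented0.
apply: (pairing_single_left T0 hf hg Hg (w := fun u => p * u `^ (p - 1))
  (Psi := fun u => u `^ p)) => //.
- exact: measurable_funM.
- by move=> u _; rewrite mulr_ge0 ?powR_ge0// ltW.
- by move=> s /andP[s0 _]; exact: integral_powR.
Qed.

Lemma represented_powR_right p : 0 < p ->
  represented (fun _ t => t `^ p) (fun _ _ => 0).
Proof.
move=> p0; apply: represented0.
apply: (pairing_single_right T0 hf hg Hf (w := fun u => p * u `^ (p - 1))
  (Psi := fun u => u `^ p)) => //.
- exact: measurable_funM.
- by move=> u _; rewrite mulr_ge0 ?powR_ge0// ltW.
- by move=> s /andP[s0 _]; exact: integral_powR.
Qed.

Let powR_le p s : 0 < p -> 0 <= s <= T -> 0 <= s `^ p <= T `^ p.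
Proof.
move=> p0 /andP[s0 sT]; rewrite powR_ge0/= ge0_ler_powR ?(ltW p0)// nnegrE//.
exact: ltW.
Qed.

Lemma represented_rectangle (k Psi : R -> R -> R) (M : R) :
  measurable_fun [set: X] (fun z => k z.1 z.2) ->
  (forall u v, 0 < u < T -> 0 < v < T -> 0 <= k u v) ->
  measurable_fun [set: X] (fun z => Psi z.1 z.2) ->
  (forall s t, 0 <= s <= T -> 0 <= t <= T -> `|Psi s t| <= M) ->
  (forall s t, 0 <= s <= T -> 0 <= t <= T ->
    (\int[mu]_(u in `]0%R, s[) \int[mu]_(v in `]0%R, t[) (k u v)%:E =
     (Psi s t)%:E)%E) ->
  (forall t, 0 < t <= T -> mu.-integrable `[0, T] (fun s => (k t s)%:E)) ->
  represented Psi (fun s t => k t s).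
Proof.
move=> mk k0 mPsi PsiM kPsi kt.
have [v [jv iv vE]] := pairing_rectangle hf hg Hf Hg mk k0 mPsi PsiM kPsi.
by split => //; rewrite vE.
Qed.

(** For [q = 1] the primitive with factor [(q * (q - 1))^-1] is not available, but
    then both [sum_power] and [power_kernel] vanish. *)
Lemma represented_sum_power p q : 0 < p -> 0 < q ->
  represented (sum_power p q) (power_kernel p q).
Proof.
move=> p0 q0; have [q1|q1] := eqVneq q 1.
  have := representedZD (-1) (represented_powR_left p0) (represented_powR_left p0).
  apply: represented_ext => [s t /andP[s0 _] /andP[t0 _]|s t _ _].
    by rewrite /sum_power q1 !mulr1 powRr1 ?addr_ge0 ?powR_ge0//; ring.
  by rewrite /power_kernel q1 subrr; ring.
have qn : q * (q - 1) != 0 by rewrite mulf_neq0 ?subr_eq0// gt_eqF.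
pose k u v := p * u `^ (p - 1) * (p * v `^ (p - 1) * (v `^ p + u `^ p) `^ (q - 2)).
pose Psi s t := (q * (q - 1))^-1 * sum_power p q s t.
have mp1 r : measurable_fun [set: X] (fun z : X => z.1 `^ r).
  exact: measurableT_comp (mpow r) measurable_fst.
have mp2 r : measurable_fun [set: X] (fun z : X => z.2 `^ r).
  exact: measurableT_comp (mpow r) measurable_snd.
have pq0 : 0 < p * q by rewrite mulr_gt0.
pose M := `|(q * (q - 1))^-1| * ((T `^ p + T `^ p) `^ q + 2 * T `^ (p * q)).
have rk : represented Psi (fun s t => k t s).
  apply: (@represented_rectangle k Psi M).
  - apply: measurable_funM.
      by apply: measurable_funM => //; exact: mp1.
    apply: measurable_funM.
      by apply: measurable_funM => //; exact: mp2.
    apply: (measurableT_comp (mpow (q - 2))) => /=.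
    by apply: measurable_funD; [exact: mp2|exact: mp1].
  - by move=> u v _ _; rewrite !mulr_ge0 ?powR_ge0// ltW.
  - rewrite /Psi /sum_power; apply: measurable_funM => //.
    apply: measurable_funB; last exact: mp2.
    apply: measurable_funB; last exact: mp1.
    apply: (measurableT_comp (mpow q)) => /=.
    by apply: measurable_funD; [exact: mp1|exact: mp2].
  - move=> s t s0T t0T; rewrite /Psi /sum_power normrM ler_wpM2l//.
    have /andP[s1 s2] := powR_le p0 s0T; have /andP[t1 t2] := powR_le p0 t0T.
    have /andP[s3 s4] := powR_le pq0 s0T; have /andP[t3 t4] := powR_le pq0 t0T.
    have h1 : (s `^ p + t `^ p) `^ q <= (T `^ p + T `^ p) `^ q.
      by rewrite ge0_ler_powR ?(ltW q0)// ?nnegrE ?addr_ge0 ?powR_ge0// lerD.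
    have h2 := powR_ge0 (s `^ p + t `^ p) q.
    move: h1 h2 s3 s4 t3 t4; clear s1 s2 t1 t2.
    move: ((s `^ p + t `^ p) `^ q) ((T `^ p + T `^ p) `^ q).
    move: (s `^ (p * q)) (t `^ (p * q)) (T `^ (p * q)).
    move=> a b c d e h1 h2 s3 s4 t3 t4.
    by rewrite ler_norml; apply/andP; split; lra.
  - move=> s t /andP[s0 _] /andP[t0 _].
    exact: integral2_powR_powRD.
  - move=> t /andP[t0 _]; pose c := p * t `^ (p - 1).
    have it : mu.-integrable `[0%R, T]
        (fun s => (p * s `^ (p - 1) * (s `^ p + t `^ p) `^ (q - 2))%:E).
      have ms : measurable_fun [set: measurableTypeR R]
          (fun s => p * s `^ (p - 1) * (s `^ p + t `^ p) `^ (q - 2)).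
        apply: measurable_funM; first exact: measurable_funM.
        by apply: (measurableT_comp (mpow (q - 2))) => /=; exact: measurable_funD.
      apply/integrableP; split.
        by apply/measurable_EFinP; exact: measurable_funTS.
      under eq_integral => s _.
        rewrite gee0_abs ?lee_fin ?mulr_ge0 ?powR_ge0 ?(ltW p0)//. over.
      rewrite integral_itv_bndoo; last first.
        by apply/measurable_EFinP; exact: measurable_funTS.
      by rewrite (integral_powR_powRD p0 q1 t0 (ltW T0)) ltry.
    by apply: eq_integrable (integrableZl mI c it).
have [z1 z2] := (represented_powR_left p0, represented_powR_left p0).
apply: represented_ext (representedZD (q * (q - 1)) rk (representedZD (-1) z1 z2)).
  by move=> s t _ _; rewrite /Psi mulVKf//; ring.
move=> s t /andP[s0 _] /andP[t0 _].
by rewrite /power_kernel powRM// /k [s `^ p + _]addrC; ring.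
Qed.

(** Fubini's theorem.  Here [kappa] is meant to be a derivative, of arbitrary
    value where it does not exist: on the axes and possibly on the diagonal.  For
    fixed [t] this concerns the two points [0] and [t] of the inner integral,
    and [t = 0] in the outer one. *)
Lemma iterated_double_integral k kappa :
  mu2.-integrable I2 (fun x => (f x.1 * g x.2 * k x.2 x.1)%:E) ->
  (forall t, 0 < t <= T -> mu.-integrable `[0, T] (fun s => (k s t)%:E)) ->
  (forall s t, 0 < s -> 0 < t -> s != t -> kappa s t = k s t) ->
  iterated_integral T f g kappa = double_integral T f g k.
Proof.
move=> ik ikt kE.
have [_ mF _ _ _] := Hf; have [[C gC] mG _ _ _] := Hg.
pose phi (x : X) : \bar R :=
  ((fun x : X => (f x.1 * g x.2 * k x.2 x.1)%:E) \_ I2) x.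
have iphi : mu2.-integrable setT phi by exact/(integrable_mkcond _ mI2).
have phiE : double_integral T f g k = (\int[mu]_t fubini_F mu phi t)%E.
  rewrite integral12_prod_meas1//.
  by rewrite /double_integral [LHS]integral_mkcond.
have mphi : measurable_fun setT (fubini_F mu phi).
  by apply: measurable_fubini_F; exact: iphi.
have mg : measurable_fun (`[0, T]%classic : set (measurableTypeR R)) g.
  exact: (measurable_restrictT g mI).2 mG.
have igk t : 0 < t <= T -> mu.-integrable `[0, T] (fun s => (g s * k s t)%:E).
  move=> t0T.
  have bg : [bounded g s | s in `[0, T]%classic].
    exists C; split; first exact: num_real.
    move=> x Cx s sI; apply: le_trans (ltW Cx).
    by have := gC s; rewrite patchE mem_set.
  by apply: eq_integrable (integrableMr mI mg bg (ikt t t0T)).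
have inner t : 0 < t <= T ->
    ((f t)%:E * \int[mu]_(s in `[0%R, T]) (g s * kappa s t)%:E =
     fubini_F mu phi t)%E.
  move=> t0T; have /andP[t0 tT] := t0T.
  have mgk := measurable_int _ (igk t t0T).
  pose D := (`[0, T]%classic `\ 0) `\ t : set R.
  have mD : measurable (D : set (measurableTypeR R)).
    by apply: measurableD => //; exact: measurableD.
  have mD0 : measurable ((`[0, T]%classic `\ 0) : set (measurableTypeR R)).
    exact: measurableD.
  have DE s : D s -> g s * kappa s t = g s * k s t.
    move=> [[]]; rewrite /= in_itv/= => /andP[s0 _] /eqP sN0 /eqP st.
    by rewrite kE// lt_neqAle eq_sym sN0.
  have mgk0 : measurable_fun (`[0, T]%classic `\ 0 : set (measurableTypeR R))
      (fun s => (g s * k s t)%:E).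
    by apply: measurable_funS mgk => //; exact: subDsetl.
  have mgkD : measurable_fun (D : set (measurableTypeR R))
      (fun s => (g s * k s t)%:E).
    by apply: measurable_funS mgk0 => //; exact: subDsetl.
  have mgkD' : measurable_fun (D : set (measurableTypeR R))
      (fun s => (g s * kappa s t)%:E).
    by apply: eq_measurable_fun mgkD => s; rewrite inE => /DE ->.
  have mgk0' : measurable_fun (`[0, T]%classic `\ 0 : set (measurableTypeR R))
      (fun s => (g s * kappa s t)%:E).
    have -> : `[0, T]%classic `\ 0 = D `|` [set t] :> set R.
      apply/esym; rewrite setUC setD1K//; split; first by rewrite /= in_itv/= ltW.
      by apply/eqP; rewrite gt_eqF.
    by apply/measurable_funU => //; split => //; exact: measurable_fun_set1.
  have -> : (\int[mu]_(s in `[0%R, T]) (g s * kappa s t)%:E =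
      \int[mu]_(s in `[0%R, T]) (g s * k s t)%:E)%E.
    rewrite -(integral_setD1 (r := 0) mD0 mgk0') -(integral_setD1 (r := 0) mD0 mgk0).
    rewrite -(integral_setD1 (r := t) mD mgkD') -(integral_setD1 (r := t) mD mgkD).
    by apply: eq_integral => s; rewrite inE => /DE ->.
  rewrite -integralZl//; last exact: igk.
  rewrite [LHS]integral_mkcond; apply: eq_integral => s _.
  rewrite /phi !patchE in_setX/= (mem_set (A := `[0, T]%classic) (u := t)); last first.
    by rewrite /= in_itv/= tT ltW.
  by case: ifPn => // _; rewrite -EFinM mulrA.
have mD0 : measurable ((`[0, T]%classic `\ 0) : set (measurableTypeR R)).
  exact: measurableD.
have D0 t : (`[0, T]%classic `\ 0) t -> 0 < t <= T.
  by move=> []; rewrite /= in_itv/= => /andP[t0 ->] /eqP tN0; rewrite lt_neqAle eq_sym tN0 t0.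
have mphi0 : measurable_fun (`[0, T]%classic `\ 0 : set (measurableTypeR R))
    (fubini_F mu phi).
  exact: measurable_funTS.
have mit : measurable_fun (`[0, T]%classic `\ 0 : set (measurableTypeR R))
    (fun t => (f t)%:E * \int[mu]_(s in `[0%R, T]) (g s * kappa s t)%:E)%E.
  by apply: eq_measurable_fun mphi0 => t; rewrite inE => /D0 /inner ->.
rewrite /iterated_integral -(integral_setD1 (r := 0) mD0 mit).
transitivity (\int[mu]_(t in `[0%R, T]%classic `\ 0%R) fubini_F mu phi t)%E.
  by apply: eq_integral => t; rewrite inE => /D0 /inner.
rewrite (integral_setD1 (r := 0) mD0 mphi0) phiE [LHS]integral_mkcond.
apply: eq_integral => t _; rewrite patchE; case: ifPn => // tN.
apply/esym; apply: integral0_eq => s _.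
by rewrite /phi patchE in_setX/= (negbTE tN).
Qed.

Lemma represented_iterated K k kappa v : represented K k -> pairing K v ->
  (forall s t, 0 < s -> 0 < t -> s != t -> kappa s t = k s t) ->
  v%:E = iterated_integral T f g kappa.
Proof.
move=> [jK ik ikt] jv kE; rewrite (iterated_double_integral ik ikt kE).
by rewrite (pairing_uniq jv jK) fineK//; exact: (integrable_fin_num mI2 ik).
Qed.

Lemma represented_double K k v : represented K k -> pairing K v ->
  v%:E = double_integral T f g k.
Proof.
move=> [jK ik _] jv.
by rewrite (pairing_uniq jv jK) fineK//; exact: (integrable_fin_num mI2 ik).
Qed.

End represented.

(** * Mixed second derivatives *)

Section mixed_derivatives.
Context {R : realType}.
Implicit Types (F : R -> R -> R) (p q r s t u v c : R).

(** Naming the first derivative [a] makes the notion stable under linear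
    combinations and under a change of [F] off the open quadrant, unlike an
    equation between values of [derive1]. *)
Definition mixed_at F s t v : Prop :=
  exists2 a : R -> R, (\forall u \near s, is_derive t 1 (F u) (a u)) &
    is_derive s 1 a v.

Lemma mixed_atZD c F1 F2 s t v1 v2 : mixed_at F1 s t v1 -> mixed_at F2 s t v2 ->
  mixed_at (fun u t' => c * F1 u t' + F2 u t') s t (c * v1 + v2).
Proof.
move=> [a1 d1 e1] [a2 d2 e2]; exists (fun u => c * a1 u + a2 u).
  near=> u.
  have h1 : is_derive t 1 (F1 u) (a1 u) by near: u.
  have h2 : is_derive t 1 (F2 u) (a2 u) by near: u.
  exact: (is_deriveD (is_deriveZ c h1) h2).
exact: (is_deriveD (is_deriveZ c e1) e2).
Unshelve. all: by end_near. Qed.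

Lemma mixed_at_ext F1 F2 s t v : 0 < s -> 0 < t ->
  (forall u t', 0 < u -> 0 < t' -> F1 u t' = F2 u t') ->
  mixed_at F1 s t v -> mixed_at F2 s t v.
Proof.
move=> s0 t0 F12 [a d e]; exists a => //; near=> u.
have u0 : 0 < u by near: u; exact: lt_nbhsr.
have h : is_derive t 1 (F1 u) (a u) by near: u.
apply: near_eq_is_derive h => //.
by near=> t'; rewrite F12//; near: t'; exact: lt_nbhsr.
Unshelve. all: by end_near. Qed.

Lemma mixed_at_sum_power p q s t : 0 < s -> 0 < t ->
  mixed_at (sum_power p q) s t (power_kernel p q s t).
Proof.
move=> s0 t0.
exists (fun u => q * p * t `^ (p - 1) * (u `^ p + t `^ p) `^ (q - 1) -
                 p * q * t `^ (p * q - 1)).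
  near=> u.
  have u0 : 0 < u by near: u; exact: lt_nbhsr.
  have d1 := is_derive_powR_powRD p q t0 (powR_ge0 u p).
  have d2 := is_derive1_powR (p * q) t0.
  have d3 := is_deriveB (is_deriveB d1 (is_derive_cst (u `^ (p * q)) t 1)) d2.
  rewrite [u `^ p + _]addrC -[X in X - _]subr0.
  rewrite (_ : sum_power p q u = fun t' => (t' `^ p + u `^ p) `^ q - u `^ (p * q) - t' `^ (p * q)).
    exact: d3.
  by apply/funext => t'; rewrite /sum_power [u `^ p + _]addrC.
have d1 := is_derive_powR_powRD p (q - 1) s0 (powR_ge0 t p).
have d2 := is_deriveB (is_deriveZ (q * p * t `^ (p - 1)) d1)
  (is_derive_cst (p * q * t `^ (p * q - 1)) s 1).
apply: (is_derive_eq d2).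
rewrite /power_kernel /GRing.scale/= subr0 (powRM _ (ltW t0) (ltW s0)).
rewrite (addrC (t `^ p)) (_ : q - 1 - 1 = q - 2); last by ring.
move: (s `^ (p - 1)) (t `^ (p - 1)) ((s `^ p + t `^ p) `^ (q - 2)) => a b d.
by ring.
Unshelve. all: by end_near. Qed.

Lemma mixed_at_has_mixed F s t v : mixed_at F s t v ->
  has_mixed F s t v /\ mixed F s t = v.
Proof.
move=> [a d e].
have e' : is_derive s 1 (fun u => derive1 (F u) t) v.
  apply: near_eq_is_derive e => //; near=> u.
  have [_] : is_derive t 1 (F u) (a u) by near: u.
  by rewrite derive1E.
split; last by rewrite /mixed derive1E; case: e'.
split => //; near=> u.
by have [] : is_derive t 1 (F u) (a u) by near: u.
Unshelve. all: by end_near. Qed.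

(** Since [F1] is [F2] plus the difference, its differentiability in [t] follows
    from theirs.  This is how a singular term common to [F1] and [F2], absent from
    the difference, is dealt with. *)
Lemma mixed_at_has_mixed_diff F1 F2 s t v :
  (\forall u \near s, derivable (F2 u) t 1) ->
  mixed_at (fun u t' => F1 u t' - F2 u t') s t v ->
  has_mixed_diff F1 F2 s t v /\ mixed_diff F1 F2 s t = v.
Proof.
move=> dF2 [a d e].
have dF1 : \forall u \near s, derivable (F1 u) t 1 /\ derivable (F2 u) t 1.
  near=> u.
  have h2 : derivable (F2 u) t 1 by near: u.
  have [h _] : is_derive t 1 (fun t' => F1 u t' - F2 u t') (a u) by near: u.
  split; last exact: h2.
  apply: near_eq_derivable (derivableD h h2).
  by near=> x; exact: subrK.
have e' : is_derive s 1 (fun u => derive1 (F1 u) t - derive1 (F2 u) t) v.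
  apply: near_eq_is_derive e => //; near=> u.
  have [h1 h2] : derivable (F1 u) t 1 /\ derivable (F2 u) t 1 by near: u.
  have [_ <-] : is_derive t 1 (fun t' => F1 u t' - F2 u t') (a u) by near: u.
  by rewrite !derive1E (deriveB h1 h2).
by split; [split|rewrite /mixed_diff derive1E; case: e'].
Unshelve. all: by end_near. Qed.

(** At 0 the difference quotient has norm [`|h| `^ (r - 1)]. *)
Lemma derivable_norm_powR r x : x != 0 \/ 1 < r ->
  derivable (fun y : R => `|y| `^ r) x 1.
Proof.
have pos y : 0 < y -> derivable (fun y : R => `|y| `^ r) y 1.
  move=> y0; have [d _] := is_derive1_powR r y0.
  apply: near_eq_derivable d => //; near=> z.
  by rewrite gtr0_norm//; near: z; exact: lt_nbhsr.
have [->|x0] := eqVneq x 0; last first.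
  move=> _; case: (ltgtP x 0) x0 => // x0 _; last exact: pos.
  have nx : 0 < - x by rewrite oppr_gt0.
  have dN : is_derive x 1 (fun y : R => - y) (-1) by exact: is_deriveN.
  have [d _] := @is_derive1_comp R (fun y => y `^ r) (fun y => - y) x _ _
    (is_derive1_powR r nx) dN.
  apply: near_eq_derivable d; near=> z.
  by rewrite /= ltr0_norm//; near: z; exact: lt_nbhsl.
move=> [//|r1].
apply/cvg_ex; exists 0; apply/cvgrPdist_le => e e0.
have r10 : 0 < r - 1 by rewrite subr_gt0.
pose d := e `^ (r - 1)^-1.
have d0 : 0 < d by rewrite powR_gt0.
near=> h.
have h0 : h != 0 by near: h; exact: nbhs_dnbhs_neq.
have hd : `|h| <= d by near: h; exact: dnbhs0_le.
have r0 : r != 0 by rewrite gt_eqF// (lt_trans _ r1).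
rewrite /= sub0r normrN addr0 normr0 powR0// subr0.
rewrite /GRing.scale/= mulr1 normrM normfV (ger0_norm (powR_ge0 _ _)).
rewrite -(mulr_powRB1 (normr_ge0 h) (lt_trans ltr01 r1)) mulKf ?normr_eq0//.
have -> : e = d `^ (r - 1).
  by rewrite /d -powRrM mulVf ?gt_eqF// powRr1// ltW.
by rewrite ge0_ler_powR ?nnegrE// ltW.
Unshelve. all: by end_near. Qed.

Lemma derivable_cov_fBm h s t : 0 < t -> s != t \/ 2^-1 < h ->
  \forall u \near s, derivable (cov_fBm h u) t 1.
Proof.
move=> t0 sth.
have st : \forall u \near s, t - u != 0 \/ 1 < 2 * h.
  case: sth => [st|h2]; last by near=> u; right; lra.
  near=> u; left; rewrite subr_eq0 eq_sym; near: u.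
  move: st; rewrite neq_lt => /orP[st|ts].
    by apply: filterS (lt_nbhsl st) => u ut; rewrite lt_eqF.
  by apply: filterS (lt_nbhsr ts) => u tu; rewrite gt_eqF.
near=> u.
have su : t - u != 0 \/ 1 < 2 * h by near: u.
have d1 : derivable (fun t' : R => `|t' - u| `^ (2 * h)) t 1.
  have /derivable1_diffP dn := derivable_norm_powR su.
  apply/derivable1_diffP.
  by apply: (@differentiable_comp _ _ _ _ (fun t' : R => t' - u)
    (fun y : R => `|y| `^ (2 * h))).
have [d2 _] := is_derive1_powR (2 * h) t0.
have d3 := @derivableZ _ _ _ _ (2^-1) _ _
  (derivableB (derivableD (derivable_cst (u `^ (2 * h)) t 1) d2) d1).
exact: d3.
Unshelve. all: by end_near. Qed.

End mixed_derivatives.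

(** * The covariances in terms of the elementary kernels *)

Section covariances.
Context {R : realType}.
Implicit Types (H K a b p q s t : R).

Lemma sum_power1E q s t : 0 <= s -> 0 <= t ->
  sum_power 1 q s t = (s + t) `^ q - s `^ q - t `^ q.
Proof. by move=> s0 t0; rewrite /sum_power !powRr1// mul1r. Qed.

Lemma power_kernel1E q s t : 0 <= s -> 0 <= t ->
  power_kernel 1 q s t = q * (q - 1) * (t + s) `^ (q - 2).
Proof.
by move=> s0 t0; rewrite /power_kernel subrr powRr0 !powRr1// expr1n mulr1 mul1r.
Qed.

Definition sign_E1 H : R := if H < 2^-1 then - 2^-1 else 2^-1.

Lemma cov_E1E H s t : 0 <= s -> 0 <= t ->
  cov_E1 H s t = sign_E1 H * sum_power 1 (2 * H) s t.
Proof.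
move=> s0 t0; rewrite /cov_E1 /sign_E1 sum_power1E// [t + s]addrC.
by case: ifP => _; ring.
Qed.

Lemma kernel_E1E H s t : 0 <= s -> 0 <= t ->
  sign_E1 H * power_kernel 1 (2 * H) s t =
  H * `|2 * H - 1| * (t + s) `^ (2 * H - 2).
Proof.
move=> s0 t0; rewrite power_kernel1E// /sign_E1; case: ltP => H2.
  by rewrite ltr0_norm; [field|lra].
by rewrite ger0_norm; [field|lra].
Qed.

Lemma cov_E2E H K s t : cov_E2 H K s t = - 1 * sum_power (2 * H) K s t.
Proof. by rewrite /cov_E2 /sum_power [t `^ _ + s `^ (2 * H)]addrC; ring. Qed.

Lemma kernel_E2E H K s t :
  - 1 * power_kernel (2 * H) K s t =
  (2 * H) ^+ 2 * K * (1 - K) * (t * s) `^ (2 * H - 1)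
  * (t `^ (2 * H) + s `^ (2 * H)) `^ (K - 2).
Proof.
rewrite /power_kernel.
by move: ((t * s) `^ _) ((t `^ _ + s `^ _) `^ _) => u v; ring.
Qed.

Lemma powR_maxE r s t :
  Num.max s t `^ r = s `^ r + t `^ r - Num.min s t `^ r.
Proof. by case: (leP s t) => st; ring. Qed.

Lemma cov_E3E H s t : 0 <= s -> 0 <= t ->
  cov_E3 H s t = 2^-1 * sum_power 1 (2 * H) s t + 2^-1 * Num.min s t `^ (2 * H).
Proof.
by move=> s0 t0; rewrite /cov_E3 sum_power1E// powR_maxE [t + s]addrC; ring.
Qed.

Lemma cov_E5E H K s t : 0 <= s -> 0 <= t ->
  cov_E5 H K s t - cov_fBm (H * K) s t =
  - 2^-1 * sum_power 1 (2 * H * K) s t + sum_power (2 * H) K s t.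
Proof.
move=> s0 t0; rewrite sum_power1E// /cov_E5 /cov_fBm /sum_power.
by rewrite mulrA [t + s]addrC; field.
Qed.

Lemma kernel_E5E H K s t : 0 <= s -> 0 <= t ->
  - 2^-1 * power_kernel 1 (2 * H * K) s t + power_kernel (2 * H) K s t =
  H * K * (4 * H * (K - 1) * (s `^ (2 * H) + t `^ (2 * H)) `^ (K - 2)
           * (t * s) `^ (2 * H - 1)
           - (2 * H * K - 1) * (s + t) `^ (2 * H * K - 2)).
Proof.
move=> s0 t0; rewrite power_kernel1E// /power_kernel.
rewrite [t + s]addrC [t `^ _ + s `^ _]addrC.
move: ((t * s) `^ _) ((s `^ _ + t `^ _) `^ _) ((s + t) `^ _) => u v w.
by field.
Qed.

Definition coef_E6 a b : R := a * b / (a ^+ 2 + b ^+ 2).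

Lemma cov_E6E H a b s t : (a, b) != (0, 0) -> 0 <= s -> 0 <= t ->
  cov_E6 H a b s t - cov_fBm H s t =
  - coef_E6 a b * sum_power 1 (2 * H) s t.
Proof.
move=> ab s0 t0; rewrite sum_power1E// /cov_E6 /cov_fBm /coef_E6.
have ab0 : a ^+ 2 + b ^+ 2 != 0.
  rewrite paddr_eq0 ?sqr_ge0// !sqrf_eq0; apply: contra ab.
  by move=> /andP[/eqP -> /eqP ->].
move: (`|t - s| `^ _) ((s + t) `^ _) (s `^ _) (t `^ _) => u v w x.
by field.
Qed.

Lemma kernel_E6E H a b s t : 0 <= s -> 0 <= t ->
  - coef_E6 a b * power_kernel 1 (2 * H) s t =
  - (2 * H * (2 * H - 1) * a * b / (a ^+ 2 + b ^+ 2)) * (t + s) `^ (2 * H - 2).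
Proof.
move=> s0 t0; rewrite power_kernel1E// /coef_E6.
by move: ((t + s) `^ _) => u; ring.
Qed.

Lemma cov_E7E H s t : cov_E7 H s t - cov_fBm H s t = - 2^-1 * Num.min s t `^ (2 * H).
Proof. by rewrite /cov_E7 /cov_fBm powR_maxE; ring. Qed.

Lemma cov_fBm_half s t : 0 <= s -> 0 <= t -> cov_fBm 2^-1 s t = Num.min s t `^ 1.
Proof.
move=> s0 t0; rewrite /cov_fBm mulfV// !powRr1// ?le_min ?s0//.
case: (leP s t) => st; first by rewrite ger0_norm ?subr_ge0//; field.
by rewrite ltr0_norm ?subr_lt0//; field.
Qed.

End covariances.

(** * Mixed derivatives of the covariances *)

Section covariance_derivatives.
Context {R : realType}.
Implicit Types (H q a b s t : R).

Lemma mixed_atZ (F : R -> R -> R) c s t v : mixed_at F s t v ->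
  mixed_at (fun u t' => c * F u t') s t (c * v).
Proof.
move=> [a d e]; exists (fun u => c * a u); last exact: (is_deriveZ c e).
near=> u; have h : is_derive t 1 (F u) (a u) by near: u.
exact: (is_deriveZ c h).
Unshelve. all: by end_near. Qed.

Lemma mixed_at_E1 H s t : 0 < s -> 0 < t ->
  mixed_at (cov_E1 H) s t (sign_E1 H * power_kernel 1 (2 * H) s t).
Proof.
move=> s0 t0; apply: mixed_at_ext (mixed_atZ (sign_E1 H)
  (mixed_at_sum_power 1 (2 * H) s0 t0)) => // u t' u0 t'0.
by rewrite cov_E1E ?ltW.
Qed.

Lemma mixed_at_E2 H q s t : 0 < s -> 0 < t ->
  mixed_at (cov_E2 H q) s t (- 1 * power_kernel (2 * H) q s t).
Proof.
move=> s0 t0; apply: mixed_at_ext (mixed_atZ (- 1)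
  (mixed_at_sum_power (2 * H) q s0 t0)) => // u t' u0 t'0.
by rewrite cov_E2E.
Qed.

Lemma mixed_diff_E5 q H s t : 0 < s -> 0 < t -> s != t \/ 2^-1 < H * q ->
  let v := - 2^-1 * power_kernel 1 (2 * H * q) s t + power_kernel (2 * H) q s t in
  has_mixed_diff (cov_E5 H q) (cov_fBm (H * q)) s t v /\
  mixed_diff (cov_E5 H q) (cov_fBm (H * q)) s t = v.
Proof.
move=> s0 t0 st /=; apply: mixed_at_has_mixed_diff.
  exact: derivable_cov_fBm.
apply: mixed_at_ext (mixed_atZD (- 2^-1) (mixed_at_sum_power 1 (2 * H * q) s0 t0)
  (mixed_at_sum_power (2 * H) q s0 t0)) => // u t' u0 t'0.
by rewrite cov_E5E ?ltW.
Qed.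

Lemma mixed_diff_E6 H a b s t : (a, b) != (0, 0) ->
  0 < s -> 0 < t -> s != t \/ 2^-1 < H ->
  let v := - coef_E6 a b * power_kernel 1 (2 * H) s t in
  has_mixed_diff (cov_E6 H a b) (cov_fBm H) s t v /\
  mixed_diff (cov_E6 H a b) (cov_fBm H) s t = v.
Proof.
move=> ab s0 t0 st /=; apply: mixed_at_has_mixed_diff.
  exact: derivable_cov_fBm.
apply: mixed_at_ext (mixed_atZ (- coef_E6 a b)
  (mixed_at_sum_power 1 (2 * H) s0 t0)) => // u t' u0 t'0.
by rewrite cov_E6E ?ltW.
Qed.

End covariance_derivatives.

(** * The inner products *)

Section pairings.
Context {R : realType} (T : R) (T0 : 0 < T)
  (nuf nug : {charge set (measurableTypeR R) -> \bar R})
  (Pf Nf Pg Ng : set R) (hf : hahn_decomposition nuf Pf Nf)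
  (hg : hahn_decomposition nug Pg Ng)
  (f g : R -> R) (Ef Eg : set R).
Hypothesis bvf : bounded_variation 0 T f.
Hypothesis bvg : bounded_variation 0 T g.
Hypothesis lsf : lebesgue_stieltjes_charge (f \_ `[0, T]) nuf.
Hypothesis lsg : lebesgue_stieltjes_charge (g \_ `[0, T]) nug.
Hypothesis Hf : stieltjes_data T f nuf Ef.
Hypothesis Hg : stieltjes_data T g nug Eg.
Implicit Types (K k : R -> R -> R) (H p q r a v : R).

Local Notation pairing := (pairing T hf hg).
Local Notation represented := (represented T hf hg f g).
Local Notation sum_powerP := (represented_sum_power T0 hf hg Hf Hg).
Local Notation mu := (@lebesgue_measure R).

Let mpow p : measurable_fun [set: measurableTypeR R] (fun u : R => u `^ p).
Proof. exact: measurable_powR. Qed.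

Lemma inner_pairing (G : centeredGaussianProcess R) (V : canonicalHilbert G T) K v :
  has_covariance G K -> pairing K v -> inner V f g = v.
Proof.
move=> GK [_ _ _ _ e]; apply: EFin_inj; rewrite -e /inner.
rewrite (ch_jolis V hf hg bvf bvg lsf lsg) /charge_prod_integral.
by congr (_ - _ - _ + _)%E; apply: eq_integral => -[s t];
  rewrite inE/= !in_itv/= => -[/andP[s0 _] /andP[t0 _]]; exact: GK.
Qed.

Lemma represented_zero : represented (fun _ _ => 0) (fun _ _ => 0).
Proof.
have h := represented_powR_left T0 hf hg f Hg ltr01.
apply: represented_ext (representedZD (-1) h h) => s t _ _; first by ring.
by ring.
Qed.

Lemma representedZ a K k : represented K k ->
  represented (fun s t => a * K s t) (fun s t => a * k s t).
Proof.
move=> h; apply: represented_ext (representedZD a h represented_zero) => s t _ _;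
  by rewrite addr0.
Qed.

Lemma inner_mixed (G : centeredGaussianProcess R) (V : canonicalHilbert G T) K k :
  has_covariance G K -> represented K k ->
  (forall s t, 0 < s -> 0 < t -> mixed_at K s t (k s t)) ->
  (inner V f g)%:E = iterated_integral T f g (mixed K).
Proof.
move=> GK rK mK; have [jK _ _] := rK; rewrite (inner_pairing V GK jK).
apply: (represented_iterated Hf Hg rK jK) => s t s0 t0 _.
by have [_ ->] := mixed_at_has_mixed (mK s t s0 t0).
Qed.

Lemma pairing_cov_fBm H : 0 < H -> exists v, pairing (cov_fBm H) v.
Proof.
move=> H0; have r0 : 0 < 2 * H by rewrite mulr_gt0.
have [jl _ _] := represented_powR_left T0 hf hg f Hg r0.
have [jr _ _] := represented_powR_right T0 hf hg g Hf r0.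
have [||v jv] := @pairing_bounded R T nuf nug Pf Nf Pg Ng hf hg
  (fun s t => `|t - s| `^ (2 * H)) (T `^ (2 * H)).
- apply: (measurableT_comp (mpow _)) => /=; apply: measurableT_comp => //.
  by apply: measurable_funB; [exact: measurable_snd|exact: measurable_fst].
- move=> s t /andP[s0 sT] /andP[t0 tT]; rewrite ger0_norm ?powR_ge0//.
  rewrite ge0_ler_powR ?nnegrE// ?(ltW r0) ?(ltW T0)//.
  by rewrite ler_norml; apply/andP; split; lra.
have j := pairingZD 2^-1 jl (pairingZD 2^-1 jr (pairingZD (- 2^-1) jv (pairingZD (-1) jl jl))).
eexists; apply: pairing_ext j => s t _ _ /=.
by rewrite /cov_fBm; ring.
Qed.

(** The covariance of the fractional Brownian motion is bounded on [0, T]^2, hence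
    has some pairing; only the difference of the two covariances has to be
    evaluated. *)
Lemma inner_sub (G B : centeredGaussianProcess R)
    (V : canonicalHilbert G T) (V1 : canonicalHilbert B T) H K L v : 0 < H ->
  has_covariance G K -> has_covariance B (cov_fBm H) ->
  (forall s t, 0 <= s <= T -> 0 <= t <= T -> K s t - cov_fBm H s t = L s t) ->
  pairing L v -> inner V f g - inner V1 f g = v.
Proof.
move=> H0 GK GB KL jL; have [v1 j1] := pairing_cov_fBm H0.
rewrite (inner_pairing V1 GB j1).
have jK : pairing K (1 * v + v1).
  apply: pairing_ext (pairingZD 1 jL j1) => s t s0T t0T.
  by rewrite -KL// mul1r subrK.
by rewrite (inner_pairing V GK jK); ring.
Qed.

Lemma inner_mixed_diff (G B : centeredGaussianProcess R)
    (V : canonicalHilbert G T) (V1 : canonicalHilbert B T) H K k : 0 < H ->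
  has_covariance G K -> has_covariance B (cov_fBm H) ->
  represented (fun s t => K s t - cov_fBm H s t) k ->
  (forall s t, 0 < s -> 0 < t -> s != t ->
    mixed_diff K (cov_fBm H) s t = k s t) ->
  (inner V f g - inner V1 f g)%:E =
  iterated_integral T f g (mixed_diff K (cov_fBm H)).
Proof.
move=> H0 GK GB rK mK; have [jK _ _] := rK.
rewrite (inner_sub V V1 H0 GK GB (fun _ _ _ _ => erefl) jK).
exact: (represented_iterated Hf Hg rK jK).
Qed.

Lemma pairing_min_powR r : 0 < r -> exists v,
  [/\ pairing (fun s t => Num.min s t `^ r) v,
   mu.-integrable `[0, T] (fun u => (f u * g u * u `^ (r - 1))%:E) &
   (r%:E * weighted_integral T f g (fun t => (t `^ (r - 1))%R) = v%:E)%E].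
Proof.
move=> r0.
have [||||v [jv iv vE]] := @pairing_min R T T0 nuf nug Pf Nf Pg Ng hf hg f g Ef Eg
  Hf Hg (fun u => r * u `^ (r - 1)) (fun u => u `^ r).
- exact: measurable_funM.
- by move=> u _; rewrite mulr_ge0 ?powR_ge0// ltW.
- exact: mpow.
- by move=> s /andP[s0 _]; exact: integral_powR.
have mI : measurable (`[0, T]%classic : set (measurableTypeR R)) by [].
have i : mu.-integrable `[0, T] (fun u => (f u * g u * u `^ (r - 1))%:E).
  apply: eq_integrable (integrableZl mI r^-1 iv) => // u _.
  by rewrite -EFinM; congr (_%:E); rewrite mulrCA mulKf// gt_eqF.
exists v; split => //; rewrite -vE /weighted_integral -integralZl//.
by apply: eq_integral => u _; rewrite -EFinM; congr (_%:E); rewrite mulrCA.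
Qed.

Lemma pairing_zero : pairing (fun _ _ => 0) 0.
Proof.
have [j _ _] := represented_zero.
rewrite (_ : double_integral T f g _ = 0%E) in j => //.
by apply: integral0_eq => x _; rewrite mulr0.
Qed.

Section null_product.
Variable Z : set R.
Hypothesis mZ : measurable (Z : set (measurableTypeR R)).
Hypothesis Z0 : lebesgue_measure Z = 0%E.
Hypothesis fgZ : forall u, 0 <= u <= T -> ~ Z u -> f u * g u = 0.

Lemma weighted_integral_null (w : R -> R) :
  mu.-integrable `[0, T] (fun u => (f u * g u * w u)%:E) ->
  weighted_integral T f g w = 0%E.
Proof.
move=> i; rewrite /weighted_integral.
have mI : measurable (`[0, T]%classic : set (measurableTypeR R)) by [].
rewrite (ae_eq_integral (cst 0%E))//.
- exact: integral0.
- exact: measurable_int i.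
- exists Z; split => // u /= /not_implyP[]; rewrite in_itv/= => u0T h.
  by apply: contrapT => uZ; apply: h; rewrite fgZ// mul0r.
Qed.

(** The covariance is half the sum of [Num.min s t `^ r], of the kernel of
    [pairing_diagonal], and of [T `^ r - (T - Num.min s t) `^ r].  The first and
    the last pair to integrals of [f * g], that is to 0.  For [H = 2^-1] the
    covariance is [Num.min s t] itself and both sides vanish. *)
Lemma pairing_cov_fBm_null H : 0 < H <= 2^-1 -> exists v, pairing (cov_fBm H) v /\
  (v%:E = (H * (2 * H - 1))%:E * double_integral T f g
     (fun s t => (`|t - s| `^ (2 * H - 2))%R))%E.
Proof.
move=> /andP[H0]; rewrite le_eqVlt => /predU1P[->|H2].
  have [v [jv iv vE]] := pairing_min_powR ltr01.
  exists v; split.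
    by apply: pairing_ext jv => s t /andP[s0 _] /andP[t0 _]; rewrite cov_fBm_half.
  by rewrite mulfV// subrr mulr0 mul0e -vE weighted_integral_null// mule0.
set r := 2 * H.
have r01 : 0 < r < 1 by rewrite /r; apply/andP; split; lra.
have /andP[r0 r1] := r01.
have [v1 [d [j1 dE v1E]]] := pairing_diagonal hf hg Hf Hg r01 mZ Z0 fgZ.
have [v2 [j2 i2 v2E]] := pairing_min_powR r0.
have [||||v3 [j3 i3 v3E]] := @pairing_min R T T0 nuf nug Pf Nf Pg Ng hf hg f g Ef Eg
  Hf Hg (fun u => r * (T - u) `^ (r - 1)) (fun u => T `^ r - (T - u) `^ r).
- apply: measurable_funM => //; apply: (measurableT_comp (mpow _)) => //=.
  exact: measurable_funB.
- by move=> u _; rewrite mulr_ge0 ?powR_ge0// ltW.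
- apply: measurable_funB => //; apply: (measurableT_comp (mpow _)) => //=.
  exact: measurable_funB.
- by move=> s s0T; exact: integral_powRB.
have v20 : v2 = 0.
  by apply: EFin_inj; rewrite -v2E weighted_integral_null// mule0.
have v30 : v3 = 0.
  by apply: EFin_inj; rewrite -v3E weighted_integral_null.
have j := pairingZD 2^-1 j2 (pairingZD 2^-1 j1 (pairingZD 2^-1 j3 pairing_zero)).
eexists; split.
  by apply: pairing_ext j => s t _ _; rewrite /cov_fBm -/r powR_maxE; ring.
by rewrite dE -EFinM; congr (_%:E); rewrite v20 v30 v1E /r /=; field.
Qed.

End null_product.

Lemma inner_E1 (G : centeredGaussianProcess R) (V : canonicalHilbert G T) H :
  0 < H -> has_covariance G (cov_E1 H) ->
  (inner V f g)%:E = iterated_integral T f g (mixed (cov_E1 H)).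
Proof.
move=> H0 GK; have r0 : 0 < 2 * H by rewrite mulr_gt0.
apply: (@inner_mixed G V _
  (fun s t => sign_E1 H * power_kernel 1 (2 * H) s t) GK).
  apply: represented_ext (representedZ (sign_E1 H)
    (sum_powerP ltr01 r0)) => s t; last by [].
  by move=> /andP[s0 _] /andP[t0 _]; rewrite cov_E1E.
by move=> s t s0 t0; exact: mixed_at_E1.
Qed.

Lemma inner_E2 (G : centeredGaussianProcess R) (V : canonicalHilbert G T) H q :
  0 < H -> 0 < q -> has_covariance G (cov_E2 H q) ->
  (inner V f g)%:E = iterated_integral T f g (mixed (cov_E2 H q)).
Proof.
move=> H0 q0 GK; have r0 : 0 < 2 * H by rewrite mulr_gt0.
apply: (@inner_mixed G V _ (fun s t => - 1 * power_kernel (2 * H) q s t) GK).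
  apply: represented_ext (representedZ (- 1) (sum_powerP r0 q0)) => s t //.
  by move=> _ _; rewrite cov_E2E.
by move=> s t s0 t0; exact: mixed_at_E2.
Qed.

Lemma inner_E3 (G : centeredGaussianProcess R) (V : canonicalHilbert G T) H :
  0 < H <= 2^-1 -> has_covariance G (cov_E3 H) ->
  (inner V f g)%:E =
  ((H * (2 * H - 1))%:E
     * double_integral T f g (fun s t => ((t + s) `^ (2 * H - 2))%R)
   + H%:E * weighted_integral T f g (fun t => (t `^ (2 * H - 1))%R))%E.
Proof.
move=> /andP[H0 H2] GK; have r0 : 0 < 2 * H by rewrite mulr_gt0.
have [v [jv _ vE]] := pairing_min_powR r0.
have wE : (H%:E * weighted_integral T f g (fun t => (t `^ (2 * H - 1))%R) =
    (2^-1 * v)%:E)%E.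
  by rewrite EFinM -vE muleA -EFinM mulrA mulVf// mul1r.
(* For [H = 2^-1] the coefficient of the double integral vanishes, and so does
   [sum_power 1 (2 * H)]; otherwise divide by it. *)
rewrite wE; have [Hh|Hh] := eqVneq H 2^-1.
  rewrite {2}Hh mulfV// subrr mulr0 mul0e add0e; congr (_%:E).
  have j := pairingZD 2^-1 jv pairing_zero; rewrite addr0 in j.
  apply: (inner_pairing V GK); apply: pairing_ext j => s t /andP[s0 _] /andP[t0 _].
  by rewrite cov_E3E// sum_power1E// Hh mulfV// !powRr1 ?addr_ge0 ?le_min ?s0//; ring.
have cn : 2 * H * (2 * H - 1) != 0.
  move: H2; rewrite le_eqVlt (negbTE Hh)/= => H2.
  by apply: mulf_neq0; [rewrite gt_eqF|rewrite lt_eqF//; lra].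
have rK := representedZ (2 * H * (2 * H - 1))^-1 (sum_powerP ltr01 r0).
have {}rK : represented
    (fun s t => (2 * H * (2 * H - 1))^-1 * sum_power 1 (2 * H) s t)
    (fun s t => (t + s) `^ (2 * H - 2)).
  apply: represented_ext rK => // s t /andP[s0 _] /andP[t0 _].
  by rewrite power_kernel1E// mulKf.
have [jK _ _] := rK; rewrite -(represented_double rK jK) -EFinM -EFinD.
congr (_%:E); apply: (inner_pairing V GK).
have jv2 := pairingZD 2^-1 jv (pairing_zero).
rewrite addr0 in jv2.
apply: pairing_ext (pairingZD (H * (2 * H - 1)) jK jv2) => s t /andP[s0 _] /andP[t0 _].
rewrite cov_E3E// addr0; congr (_ + _).
by move: cn; move: (sum_power _ _ _ _) => u cn; field; move: cn;
  rewrite !mulf_eq0 !negb_or => /andP[/andP[_ ->] ->].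
Qed.

Lemma inner_E4 (G : centeredGaussianProcess R) (V : canonicalHilbert G T) H :
  0 < H -> has_covariance G (cov_E4 H) ->
  (inner V f g)%:E =
  ((2 * H * Gamma (1 - 2 * H))%:E
     * weighted_integral T f g (fun t => (t `^ (2 * H - 1))%R))%E.
Proof.
move=> H0 GK; have r0 : 0 < 2 * H by rewrite mulr_gt0.
have [v [jv _ vE]] := pairing_min_powR r0.
rewrite [(2 * H * _)%R]mulrC EFinM -muleA vE -EFinM; congr (_%:E).
apply: (inner_pairing V GK).
have := pairingZD (Gamma (1 - 2 * H)) jv pairing_zero; rewrite addr0.
by apply: pairing_ext => s t _ _; rewrite addr0.
Qed.

Lemma inner_E5 (G B : centeredGaussianProcess R)
    (V : canonicalHilbert G T) (V1 : canonicalHilbert B T) H q :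
  0 < H -> 0 < q ->
  has_covariance G (cov_E5 H q) -> has_covariance B (cov_fBm (H * q)) ->
  (inner V f g - inner V1 f g)%:E =
  iterated_integral T f g (mixed_diff (cov_E5 H q) (cov_fBm (H * q))).
Proof.
move=> H0 q0 GK GB; have r0 : 0 < 2 * H by rewrite mulr_gt0.
have rq0 : 0 < 2 * H * q by rewrite mulr_gt0.
apply: (@inner_mixed_diff G B V V1 (H * q) _
  (fun s t => - 2^-1 * power_kernel 1 (2 * H * q) s t +
              power_kernel (2 * H) q s t) _ GK GB).
- by rewrite mulr_gt0.
- apply: represented_ext (representedZD (- 2^-1)
    (sum_powerP ltr01 rq0) (sum_powerP r0 q0)) => s t //.
  by move=> /andP[s0 _] /andP[t0 _]; rewrite cov_E5E.
- by move=> s t s0 t0 st; have [_ ->] := @mixed_diff_E5 R q H s t s0 t0 (or_introl st).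
Qed.

Lemma inner_E6 (G B : centeredGaussianProcess R)
    (V : canonicalHilbert G T) (V1 : canonicalHilbert B T) H a b :
  0 < H -> (a, b) != (0, 0) ->
  has_covariance G (cov_E6 H a b) -> has_covariance B (cov_fBm H) ->
  (inner V f g - inner V1 f g)%:E =
  iterated_integral T f g (mixed_diff (cov_E6 H a b) (cov_fBm H)).
Proof.
move=> H0 ab GK GB; have r0 : 0 < 2 * H by rewrite mulr_gt0.
apply: (@inner_mixed_diff G B V V1 H _
  (fun s t => - coef_E6 a b * power_kernel 1 (2 * H) s t) H0 GK GB).
- apply: represented_ext (representedZ (- coef_E6 a b)
    (sum_powerP ltr01 r0)) => s t //.
  by move=> /andP[s0 _] /andP[t0 _]; rewrite cov_E6E.
- by move=> s t s0 t0 st; have [_ ->] := @mixed_diff_E6 R H a b s t ab s0 t0 (or_introl st).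
Qed.

Lemma inner_E7 (G B : centeredGaussianProcess R)
    (V : canonicalHilbert G T) (V1 : canonicalHilbert B T) H :
  0 < H -> has_covariance G (cov_E7 H) -> has_covariance B (cov_fBm H) ->
  (inner V f g - inner V1 f g)%:E =
  (- (H%:E * weighted_integral T f g (fun t => (t `^ (2 * H - 1))%R)))%E.
Proof.
move=> H0 GK GB; have r0 : 0 < 2 * H by rewrite mulr_gt0.
have [v [jv _ vE]] := pairing_min_powR r0.
have -> : (H%:E * weighted_integral T f g (fun t => (t `^ (2 * H - 1))%R) =
    (2^-1 * v)%:E)%E.
  by rewrite EFinM -vE muleA -EFinM mulrA mulVf// mul1r.
rewrite -EFinN -mulNr; congr (_%:E).
have j := pairingZD (- 2^-1) jv pairing_zero; rewrite addr0 in j.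
apply: (inner_sub V V1 H0 GK GB _ j) => s t _ _.
by rewrite cov_E7E addr0.
Qed.

Lemma inner_E7_disjoint (G B : centeredGaussianProcess R)
    (V : canonicalHilbert G T) (V1 : canonicalHilbert B T) H :
  0 < H <= 2^-1 -> has_covariance G (cov_E7 H) -> has_covariance B (cov_fBm H) ->
  lebesgue_measure (support_on T f `&` support_on T g) = 0%E ->
  inner V f g = inner V1 f g /\
  (inner V1 f g)%:E =
  ((H * (2 * H - 1))%:E
     * double_integral T f g (fun s t => (`|t - s| `^ (2 * H - 2))%R))%E.
Proof.
move=> /andP[H0 H2] GK GB; set Z := _ `&` _ => Z0.
have r0 : 0 < 2 * H by rewrite mulr_gt0.
have mZ : measurable (Z : set (measurableTypeR R)).
  by apply: measurableI; apply: closed_measurable; exact: closed_closure.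
have fgZ u : 0 <= u <= T -> ~ Z u -> f u * g u = 0.
  move=> u0T uZ; apply/eqP; rewrite mulf_eq0; apply: contrapT => /negP.
  rewrite negb_or => /andP[fu gu]; apply: uZ.
  by split; apply: subset_closure; split; rewrite //= in_itv.
have [v [_ iv _]] := pairing_min_powR r0.
have e := inner_E7 V V1 H0 GK GB.
rewrite (weighted_integral_null mZ Z0 fgZ iv) mule0 oppe0 in e.
split; first by apply/eqP; rewrite -subr_eq0; apply/eqP/EFin_inj.
have [v1 [j1 <-]] := pairing_cov_fBm_null mZ Z0 fgZ (introT andP (conj H0 H2)).
by rewrite (inner_pairing V1 GB j1).
Qed.

End pairings.

Theorem proposition1p10 (R : realType) (T : R) (f g : R -> R)
    (G : centeredGaussianProcess R) (V : canonicalHilbert G T) :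
  0 < T -> bounded_variation 0 T f -> bounded_variation 0 T g ->
  [/\
   (* (i) *)
   (forall H : R, 0 < H < 1 -> H != 2^-1 -> has_covariance G (cov_E1 H) ->
      (inner V f g)%:E = iterated_integral T f g (mixed (cov_E1 H)) /\
      (forall s t, 0 < s -> 0 < t ->
         has_mixed (cov_E1 H) s t
           (H * `|2 * H - 1| * (t + s) `^ (2 * H - 2)))) /\
   (forall H' K : R, 0 < H' < 1 -> 0 < K < 1 ->
      has_covariance G (cov_E2 H' K) ->
      (inner V f g)%:E = iterated_integral T f g (mixed (cov_E2 H' K)) /\
      (forall s t, 0 < s -> 0 < t ->
         has_mixed (cov_E2 H' K) s t
           ((2 * H') ^+ 2 * K * (1 - K) * (t * s) `^ (2 * H' - 1)
            * (t `^ (2 * H') + s `^ (2 * H')) `^ (K - 2)))),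
   (* (ii) *)
   (forall H : R, 0 < H <= 2^-1 -> has_covariance G (cov_E3 H) ->
      (inner V f g)%:E =
      ((H * (2 * H - 1))%:E
         * double_integral T f g (fun s t => ((t + s) `^ (2 * H - 2))%R)
       + H%:E * weighted_integral T f g (fun t => (t `^ (2 * H - 1))%R))%E),
   (* (iii) *)
   (forall H : R, 0 < H < 2^-1 -> has_covariance G (cov_E4 H) ->
      (inner V f g)%:E =
      ((2 * H * Gamma (1 - 2 * H))%:E
         * weighted_integral T f g (fun t => (t `^ (2 * H - 1))%R))%E),
   (* (iv) *)
   (forall H' K : R, 0 < H' < 1 -> 0 < K < 2 -> 0 < H' * K < 1 ->
      has_covariance G (cov_E5 H' K) ->
      (forall (B : centeredGaussianProcess R) (V1 : canonicalHilbert B T),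
         has_covariance B (cov_fBm (H' * K)) ->
         (inner V f g - inner V1 f g)%:E =
         iterated_integral T f g
           (mixed_diff (cov_E5 H' K) (cov_fBm (H' * K)))) /\
      (forall s t, 0 < s -> 0 < t -> s != t \/ 2^-1 < H' * K ->
         has_mixed_diff (cov_E5 H' K) (cov_fBm (H' * K)) s t
           (H' * K *
            (4 * H' * (K - 1) * (s `^ (2 * H') + t `^ (2 * H')) `^ (K - 2)
               * (t * s) `^ (2 * H' - 1)
             - (2 * H' * K - 1) * (s + t) `^ (2 * H' * K - 2))))) /\
   (forall H a b : R, 0 < H < 1 -> (a, b) != (0, 0) ->
      has_covariance G (cov_E6 H a b) ->
      (forall (B : centeredGaussianProcess R) (V1 : canonicalHilbert B T),
         has_covariance B (cov_fBm H) ->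
         (inner V f g - inner V1 f g)%:E =
         iterated_integral T f g (mixed_diff (cov_E6 H a b) (cov_fBm H))) /\
      (forall s t, 0 < s -> 0 < t -> s != t \/ 2^-1 < H ->
         has_mixed_diff (cov_E6 H a b) (cov_fBm H) s t
           (- (2 * H * (2 * H - 1) * a * b / (a ^+ 2 + b ^+ 2))
            * (t + s) `^ (2 * H - 2)))) &
   (* (v) *)
   (forall H : R, 0 < H <= 2^-1 -> has_covariance G (cov_E7 H) ->
      forall (B : centeredGaussianProcess R) (V1 : canonicalHilbert B T),
      has_covariance B (cov_fBm H) ->
      (inner V f g - inner V1 f g)%:E =
      (- (H%:E * weighted_integral T f g (fun t => (t `^ (2 * H - 1))%R)))%E /\
      (lebesgue_measure (support_on T f `&` support_on T g) = 0%E ->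
       inner V f g = inner V1 f g /\
       (inner V1 f g)%:E =
       ((H * (2 * H - 1))%:E
          * double_integral T f g
              (fun s t => (`|t - s| `^ (2 * H - 2))%R))%E))].
Proof.
move=> T0 bvf bvg.
have [nuf [Ef [lsf Hf]]] := bounded_variation_stieltjes T0 bvf.
have [nug [Eg [lsg Hg]]] := bounded_variation_stieltjes T0 bvg.
have [Pf [Nf hf]] := Hahn_decomposition nuf.
have [Pg [Ng hg]] := Hahn_decomposition nug.
split.
- split=> [H /andP[H0 _] _ GK|H q /andP[H0 _] /andP[q0 _] GK].
    split; first exact: (inner_E1 T0 hf hg bvf bvg lsf lsg Hf Hg V H0 GK).
    move=> s t s0 t0; rewrite -kernel_E1E ?ltW//.
    by have [] := mixed_at_has_mixed (mixed_at_E1 H s0 t0).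
  split; first exact: (inner_E2 T0 hf hg bvf bvg lsf lsg Hf Hg V H0 q0 GK).
  move=> s t s0 t0; rewrite -kernel_E2E.
  by have [] := mixed_at_has_mixed (mixed_at_E2 H q s0 t0).
- by move=> H H01 GK; exact: (inner_E3 T0 hf hg bvf bvg lsf lsg Hf Hg V H01 GK).
- move=> H /andP[H0 _] GK.
  exact: (inner_E4 T0 hf hg bvf bvg lsf lsg Hf Hg V H0 GK).
- split=> [H q /andP[H0 _] /andP[q0 _] _ GK|H a b /andP[H0 _] ab GK].
    split=> [B V1 GB|s t s0 t0 st].
      exact: (inner_E5 T0 hf hg bvf bvg lsf lsg Hf Hg V V1 H0 q0 GK GB).
    rewrite -kernel_E5E ?ltW//.
    by have [] := @mixed_diff_E5 R q H s t s0 t0 st.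
  split=> [B V1 GB|s t s0 t0 st].
    exact: (inner_E6 T0 hf hg bvf bvg lsf lsg Hf Hg V V1 H0 ab GK GB).
  rewrite -kernel_E6E ?ltW//.
  by have [] := @mixed_diff_E6 R H a b s t ab s0 t0 st.
- move=> H H02 GK B V1 GB; have /andP[H0 _] := H02; split.
    exact: (inner_E7 T0 hf hg bvf bvg lsf lsg Hf Hg V V1 H0 GK GB).
  move=> Z0.
  exact: (inner_E7_disjoint T0 hf hg bvf bvg lsf lsg Hf Hg V V1 H02 GK GB Z0).
Qed.
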